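(* Let $(\mathcal{G},S_m)$ be a graph of groups on the star graph $S_m$ with a free group of finite rank associated to the central vertex, free abelian groups of finite rank associated to the external vertices, and cyclic edge groups. For each edge $e_i$, $i=1,\dots,m$, let $k_i$ be a generator of the edge group $G_{e_i}$, and let $\alpha_{e_i}$ and $\omega_{e_i}$ be the monomorphisms of $G_{e_i}$ into the central vertex group and the corresponding external vertex group respectively. Assume that $\omega_{e_i}(k_i)$ is primitive in the external vertex group for all $i=1,\dots,m$. Then the fundamental group $G=\pi_1(\mathcal{G},S_m)$ is $\mathbb{Z}$-linear.
   Context: The star graph $S_m$ is the tree with one central vertex joined by edges $e_1,\dots,e_m$ to $m$ external vertices (leaves); each $e_i$ is oriented from the central vertex to the leaf. If $F$ is the central vertex group and $K_1,\dots,K_m$ are the external vertex groups, $\pi_1(\mathcal{G},S_m)$ is the quotient of the free product $F*K_1*\cdots*K_m$ by the relations $\alpha_{e_i}(g)=\omega_{e_i}(g)$ for $g\in G_{e_i}$, $i=1,\dots,m$. A word $w$ (element) of a free abelian group of finite rank is primitive if it can be extended to a free generating set (a basis) of the group. A group is $\mathbb{Z}$-linear if it admits a faithful representation into $GL_n(\mathbb{Z})$ for some $n$. *)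

(* Defs.v *)
From HB Require Import structures.
From mathcomp Require Import all_boot all_algebra.
From mathcomp Require Import boolp.

Set Implicit Arguments.
Unset Strict Implicit.
Unset Printing Implicit Defensive.

Local Open Scope quotient_scope.
Local Open Scope group_scope.

(* The free product of a family of groups: words in the disjoint union of the
   groups, modulo the smallest congruence that identifies the one-letter word
   of a unit with the empty word and multiplies adjacent letters lying in the
   same factor.  Equality of words is made boolean with classical logic. *)
Section FreeProduct.
Variables (I : choiceType) (A : I -> groupType).

Definition word := seq {i : I & A i}.

Definition letter (i : I) (a : A i) : {i : I & A i} := existT _ i a.

Inductive word_eq : word -> word -> Prop :=
| word_eq_refl u : word_eq u u
| word_eq_sym u v : word_eq u v -> word_eq v u
| word_eq_trans u v w : word_eq u v -> word_eq v w -> word_eq u w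
| word_eq_cat u u' v v' :
    word_eq u u' -> word_eq v v' -> word_eq (u ++ v) (u' ++ v')
| word_eq_one i : word_eq [:: letter (1 : A i)] [::]
| word_eq_mul i (a b : A i) : word_eq [:: letter a; letter b] [:: letter (a * b)].

Definition word_eqb : rel word := fun u v => `[< word_eq u v >].

Lemma word_eqb_refl : reflexive word_eqb.
Proof. by move=> u; apply/asboolP; exact: word_eq_refl. Qed.

Lemma word_eqb_sym : symmetric word_eqb.
Proof. by move=> u v; apply/asboolP/asboolP; exact: word_eq_sym. Qed.

Lemma word_eqb_trans : transitive word_eqb.
Proof.
by move=> v u w /asboolP uv /asboolP vw; apply/asboolP; apply: word_eq_trans vw.
Qed.

Canonical word_equiv :=
  EquivRel word_eqb word_eqb_refl word_eqb_sym word_eqb_trans.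

Definition freeprod := {eq_quot word_equiv}.
HB.instance Definition _ := Choice.on freeprod.

Definition fp_word (u : word) : freeprod := \pi_freeprod u.

Lemma fp_wordP u v : fp_word u = fp_word v <-> word_eq u v.
Proof.
split=> [/eqquotP /asboolP //|uv]; by apply/eqquotP/asboolP.
Qed.

Lemma fp_wordK (x : freeprod) : fp_word (repr x) = x.
Proof. exact: reprK. Qed.

Definition word_inv (u : word) : word :=
  rev [seq (let: existT i a := l in letter a^-1) | l : {i : I & A i} <- u].

Lemma word_inv_cat u v : word_inv (u ++ v) = word_inv v ++ word_inv u.
Proof. by rewrite /word_inv map_cat rev_cat. Qed.

Lemma word_inv_eq u v : word_eq u v -> word_eq (word_inv u) (word_inv v).
Proof.
elim=> {u v} [u|u v _|u v w _ uv _|u u' v v' _ uu' _ vv'|i|i a b].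
- exact: word_eq_refl.
- exact: word_eq_sym.
- exact: word_eq_trans uv.
- by rewrite !word_inv_cat; exact: word_eq_cat.
- by rewrite /word_inv /rev /= invg1; exact: word_eq_one.
- by rewrite /word_inv /rev /= invgM; exact: word_eq_mul.
Qed.

Lemma word_mulV u : word_eq (word_inv u ++ u) [::].
Proof.
elim: u => [|[i a] u IHu]; first exact: word_eq_refl.
rewrite -cat1s word_inv_cat -catA (catA _ [:: _] u).
apply: word_eq_trans IHu; apply: word_eq_cat; first exact: word_eq_refl.
rewrite -[X in word_eq _ X]cat0s; apply: word_eq_cat; last exact: word_eq_refl.
rewrite /word_inv /rev /=; apply: word_eq_trans (word_eq_mul _ _) _.
by rewrite mulVg; exact: word_eq_one.
Qed.

Lemma word_invK : involutive word_inv.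
Proof.
move=> u; rewrite /word_inv map_rev revK -map_comp -[RHS]map_id.
by apply: eq_map => -[i a] /=; rewrite invgK.
Qed.

Lemma word_mulgV u : word_eq (u ++ word_inv u) [::].
Proof. by rewrite -[X in word_eq (X ++ _)]word_invK; exact: word_mulV. Qed.

Definition fp_mul (x y : freeprod) : freeprod := fp_word (repr x ++ repr y).
Definition fp_one : freeprod := fp_word [::].
Definition fp_inv (x : freeprod) : freeprod := fp_word (word_inv (repr x)).

Lemma fp_repr u : word_eq (repr (fp_word u)) u.
Proof. by apply/fp_wordP; rewrite fp_wordK. Qed.

Lemma fp_mulE u v : fp_mul (fp_word u) (fp_word v) = fp_word (u ++ v).
Proof. by apply/fp_wordP; apply: word_eq_cat; exact: fp_repr. Qed.

Lemma fp_invE u : fp_inv (fp_word u) = fp_word (word_inv u).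
Proof. by apply/fp_wordP; apply: word_inv_eq; exact: fp_repr. Qed.

Lemma fp_mulA : associative fp_mul.
Proof.
move=> x y z; rewrite -(fp_wordK x) -(fp_wordK y) -(fp_wordK z).
by rewrite !fp_mulE catA.
Qed.

Lemma fp_mul1 : left_id fp_one fp_mul.
Proof. by move=> x; rewrite -(fp_wordK x) fp_mulE. Qed.

Lemma fp_mulr1 : right_id fp_one fp_mul.
Proof. by move=> x; rewrite -(fp_wordK x) fp_mulE cats0. Qed.

Lemma fp_mulV : left_inverse fp_one fp_inv fp_mul.
Proof.
move=> x; rewrite -(fp_wordK x) fp_invE fp_mulE.
by apply/fp_wordP; exact: word_mulV.
Qed.

Lemma fp_mulgV : right_inverse fp_one fp_inv fp_mul.
Proof.
move=> x; rewrite -(fp_wordK x) fp_invE fp_mulE.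
by apply/fp_wordP; exact: word_mulgV.
Qed.

HB.instance Definition _ :=
  isGroup.Build freeprod fp_mulA fp_mul1 fp_mulr1 fp_mulV fp_mulgV.

Definition fp_inj (i : I) (a : A i) : freeprod := fp_word [:: letter a].

Lemma fp_injM i : {morph @fp_inj i : a b / a * b}.
Proof.
move=> a b; rewrite [RHS]fp_mulE; apply/fp_wordP.
exact: word_eq_sym (word_eq_mul _ _).
Qed.

HB.instance Definition _ i :=
  isMultiplicative.Build (A i) freeprod (@fp_inj i) (@fp_injM i).

End FreeProduct.

Section NormalQuotient.
Variables (G : groupType) (S : G -> Prop).

Inductive normal_closure : G -> Prop :=
| normal_closure_gen x : S x -> normal_closure x
| normal_closure_one : normal_closure 1
| normal_closure_mul x y :
    normal_closure x -> normal_closure y -> normal_closure (x * y)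
| normal_closure_inv x : normal_closure x -> normal_closure x^-1
| normal_closure_conj x y : normal_closure x -> normal_closure (x ^ y).

Definition nquot_eqb : rel G := fun x y => `[< normal_closure (x^-1 * y) >].

Lemma nquot_eqb_refl : reflexive nquot_eqb.
Proof.
by move=> x; apply/asboolP; rewrite mulVg; exact: normal_closure_one.
Qed.

Lemma nquot_eqb_sym : symmetric nquot_eqb.
Proof.
by move=> x y; apply/asboolP/asboolP => /normal_closure_inv; rewrite invgM invgK.
Qed.

Lemma nquot_eqb_trans : transitive nquot_eqb.
Proof.
move=> y x z /asboolP xy /asboolP yz; apply/asboolP.
by have := normal_closure_mul xy yz; rewrite mulgA mulgK.
Qed.

Canonical nquot_equiv :=
  EquivRel nquot_eqb nquot_eqb_refl nquot_eqb_sym nquot_eqb_trans.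

Definition nquot := {eq_quot nquot_equiv}.
HB.instance Definition _ := Choice.on nquot.

Definition nquot_pi (x : G) : nquot := \pi_nquot x.

Lemma nquot_piP x y : nquot_pi x = nquot_pi y <-> normal_closure (x^-1 * y).
Proof.
split=> [/eqquotP /asboolP //|xy]; by apply/eqquotP/asboolP.
Qed.

Lemma nquot_piK (x : nquot) : nquot_pi (repr x) = x.
Proof. exact: reprK. Qed.

Definition nquot_mul (x y : nquot) : nquot := nquot_pi (repr x * repr y).
Definition nquot_one : nquot := nquot_pi 1.
Definition nquot_inv (x : nquot) : nquot := nquot_pi (repr x)^-1.

Lemma nquot_repr x : normal_closure ((repr (nquot_pi x))^-1 * x).
Proof. by apply/nquot_piP; rewrite nquot_piK. Qed.

Lemma nquot_mulE x y : nquot_mul (nquot_pi x) (nquot_pi y) = nquot_pi (x * y).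
Proof.
apply/nquot_piP; set a := repr _; set b := repr _.
have -> : (a * b)^-1 * (x * y) = (a^-1 * x) ^ b * (b^-1 * y).
  by rewrite /conjg invgM !mulgA mulgK.
apply: normal_closure_mul (nquot_repr _).
by apply: normal_closure_conj; exact: nquot_repr.
Qed.

Lemma nquot_invE x : nquot_inv (nquot_pi x) = nquot_pi x^-1.
Proof.
apply/nquot_piP; set a := repr _.
have -> : a^-1^-1 * x^-1 = ((a^-1 * x)^-1) ^ a^-1.
  by rewrite /conjg invgM !invgK !mulgA mulgK.
by apply: normal_closure_conj; apply: normal_closure_inv; exact: nquot_repr.
Qed.

Lemma nquot_mulA : associative nquot_mul.
Proof.
move=> x y z; rewrite -(nquot_piK x) -(nquot_piK y) -(nquot_piK z).
by rewrite !nquot_mulE mulgA.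
Qed.

Lemma nquot_mul1 : left_id nquot_one nquot_mul.
Proof. by move=> x; rewrite -(nquot_piK x) nquot_mulE mul1g. Qed.

Lemma nquot_mulr1 : right_id nquot_one nquot_mul.
Proof. by move=> x; rewrite -(nquot_piK x) nquot_mulE mulg1. Qed.

Lemma nquot_mulV : left_inverse nquot_one nquot_inv nquot_mul.
Proof. by move=> x; rewrite -(nquot_piK x) nquot_invE nquot_mulE mulVg. Qed.

Lemma nquot_mulgV : right_inverse nquot_one nquot_inv nquot_mul.
Proof. by move=> x; rewrite -(nquot_piK x) nquot_invE nquot_mulE mulgV. Qed.

HB.instance Definition _ :=
  isGroup.Build nquot nquot_mulA nquot_mul1 nquot_mulr1 nquot_mulV nquot_mulgV.

Lemma nquot_piM : {morph nquot_pi : x y / x * y}.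
Proof. by move=> x y; rewrite [RHS]nquot_mulE. Qed.

HB.instance Definition _ := isMultiplicative.Build G nquot nquot_pi nquot_piM.

End NormalQuotient.

(* A graph of groups on the star graph with m edges; edge i joins the central
   vertex (its origin) to the i-th leaf (its terminus).  Between groups, a
   {multiplicative _ -> _} preserves units and inverses. *)
Record star_of_groups (m : nat) := StarOfGroups {
  center : groupType;
  leaf : 'I_m -> groupType;
  edge : 'I_m -> groupType;
  alpha : forall i, {multiplicative edge i -> center};
  omega : forall i, {multiplicative edge i -> leaf i};
  alpha_inj : forall i, injective (alpha i);
  omega_inj : forall i, injective (omega i)
}.

Section FundamentalGroup.
Variables (m : nat) (GG : star_of_groups m).

(* None is the central vertex, Some i the i-th leaf. *)
Definition vertex_group (v : option 'I_m) : groupType :=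
  if v is Some i then leaf GG i else center GG.

Definition in_center (x : center GG) : freeprod vertex_group :=
  fp_inj (A := vertex_group) (i := None) x.

Definition in_leaf (i : 'I_m) (x : leaf GG i) : freeprod vertex_group :=
  fp_inj (A := vertex_group) (i := Some i) x.

Definition edge_relator (r : freeprod vertex_group) : Prop :=
  exists (i : 'I_m) (g : edge GG i),
    r = in_center (alpha GG i g) * (in_leaf (omega GG i g))^-1.

Definition star_pi1 : groupType := nquot edge_relator.

End FundamentalGroup.

Definition free_basis (F : groupType) (n : nat) (x : 'I_n -> F) : Prop :=
  forall (H : groupType) (y : 'I_n -> H),
    exists2 f : {multiplicative F -> H},
      forall j, f (x j) = y j
      & forall g : {multiplicative F -> H}, (forall j, g (x j) = y j) -> g =1 f.

Definition free_of_finite_rank (F : groupType) : Prop :=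
  exists (n : nat) (x : 'I_n -> F), free_basis x.

Definition abelian_group (K : groupType) : Prop := forall a b : K, commute a b.

Definition free_abelian_basis (K : groupType) (n : nat) (x : 'I_n -> K) : Prop :=
  forall (H : groupType) (y : 'I_n -> H), abelian_group H ->
    exists2 f : {multiplicative K -> H},
      forall j, f (x j) = y j
      & forall g : {multiplicative K -> H}, (forall j, g (x j) = y j) -> g =1 f.

Definition free_abelian_of_finite_rank (K : groupType) : Prop :=
  abelian_group K /\ exists (n : nat) (x : 'I_n -> K), free_abelian_basis x.

(* w extends to a basis: it is a member of some finite basis.  Meant for K free
   abelian of finite rank, whose bases are all finite. *)
Definition primitive (K : groupType) (w : K) : Prop :=
  exists (n : nat) (x : 'I_n -> K), free_abelian_basis x /\ exists j, w = x j.

Definition cyclic_generator (E : groupType) (k : E) : Prop :=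
  forall g : E, exists n : nat, g = k ^+ n \/ g = k ^- n.

(* GL_n(Z) is the set of matrices in unitmx, with product *m and unit 1%:M. *)
Definition Z_linear (G : groupType) : Prop :=
  exists (n : nat) (rho : G -> 'M[int]_n),
    [/\ forall g, rho g \in unitmx,
        rho 1 = 1%:M%R,
        forall g h, rho (g * h) = (rho g *m rho h)%R
      & injective rho].

(* Main.v *)
From HB Require Import structures.
Require Import Defs.
From mathcomp Require Import all_boot all_order all_algebra perm.
From mathcomp Require Import boolp.
From mathcomp Require Import ring zify.

(** Let [F] be the central free group, [u_i] and [w_i] the images of [k_i] in
    [F] and in the leaf group [K_i].  Since [w_i] belongs to a basis,
    [K_i = <w_i> x L_i] with [L_i] free abelian.  Killing all the [L_i] retracts
    the fundamental group [G] onto [F], and the kernel is the free product of the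
    conjugates [f L_i f^-1], one for each coset [f <u_i>].  A representation that is
    faithful on [F] is therefore faithful on [G] as soon as these conjugates are
    seen to generate their free product; this is done by ping-pong.

    The ping-pong takes place in a lattice [W] with an integral symmetric form
    [B], on which [F] acts by isometries.  Suppose that [W] contains isotropic
    vectors [delta_i] with [B d d' <= -2] for any two distinct vectors [d], [d'] of
    the union of the orbits [F delta_i], such that the stabilizer of [delta_i] is
    exactly [<u_i>] and the orbits are disjoint.  Let [L_i] act by the parabolic
    isometries (Eichler transvections) that fix [delta_i]; they commute with [u_i],
    so that [F] and the [K_i] act compatibly.  The conjugate [f L_i f^-1] consists
    of parabolics at the cusp [f delta_i], distinct cosets have distinct cusps, and a
    product of nontrivial parabolics at successively distinct cusps moves a
    vector fixed by [F] ([ping_pong]).  Every element of [G] is an element of [F]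
    preceded by such a product ([syllables_alternating]), which gives faithfulness
    ([extension_faithful]).

    What remains is to find, for a single [u <> 1] in [F], an isometric integral
    representation and a vector [e] fixed by [u] with [B e e = 1] and
    [B e (f e) <= 0] for every [f] outside [<u>] ([cyclic_separation]).  Up to
    conjugation [u] is a cyclically reduced word.  Its letters label the edges of an
    embedded loop; add vertices if wished, complete this labelled graph to one on
    which every generator of [F] acts as a permutation of the vertices, and attach
    to each edge an element of [PSL_2(Z)]: a translation [z -> z + 2 M] along the
    loop, and elsewhere an element [z -> p - 1/(z - q)], where the even integers [p]
    and [q] are all distinct and lie between 0 and [2 M].  A reduced word that leaves
    the loop multiplies to a matrix described by a continued fraction whose partial
    quotients have absolute value at least 2, so that its lower left entry [y] is
    nonzero ([reduced_walk]).  Letting [PSL_2(Z)] act on binary quadratic forms turns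
    this entry into the matrix coefficient [1 - y * y] of an isometric
    representation.  Loops at the base vertex that stay on the graph of [u] are
    powers of [u]; hence the coefficient is positive only on [<u>]. *)

Set Implicit Arguments.
Unset Strict Implicit.
Unset Printing Implicit Defensive.

Import Order.TTheory GRing.Theory Num.Theory VectorInternalTheory.

(** * Groups of bijections and integer powers *)

Local Open Scope group_scope.

(** The inverse is a field, so that the inverse in the group computes. *)
Record bij (T : Type) := Bij {
  bij_fun :> T -> T;
  bij_inv : T -> T;
  bij_funK : cancel bij_fun bij_inv;
  bij_invK : cancel bij_inv bij_fun }.

Lemma bijP (T : Type) (a b : bij T) : a =1 b -> a = b.
Proof.
case: a b => [f g fK gK] [f' g' fK' gK'] /= /funext E; subst f'.
have E : g = g' by apply: funext => x; rewrite -[in LHS](gK' x) fK.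
by subst g'; rewrite (Prop_irrelevance fK fK') (Prop_irrelevance gK gK').
Qed.

HB.instance Definition _ (T : Type) := gen_eqMixin (bij T).
HB.instance Definition _ (T : Type) := gen_choiceMixin (bij T).

Section BijGroup.
Variable T : Type.

Definition bij_one : bij T := @Bij T id id (fun=> erefl) (fun=> erefl).
Definition bij_mul (a b : bij T) : bij T :=
  Bij (can_comp (bij_funK a) (bij_funK b)) (can_comp (bij_invK b) (bij_invK a)).
Definition bij_V (a : bij T) : bij T := Bij (bij_invK a) (bij_funK a).

Lemma bij_mulA : associative bij_mul. Proof. by move=> a b c; apply: bijP. Qed.
Lemma bij_mul1 : left_id bij_one bij_mul. Proof. by move=> a; apply: bijP. Qed.
Lemma bij_mulr1 : right_id bij_one bij_mul. Proof. by move=> a; apply: bijP. Qed.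
Lemma bij_mulV : left_inverse bij_one bij_V bij_mul.
Proof. by move=> a; apply: bijP => x /=; rewrite bij_funK. Qed.
Lemma bij_mulgV : right_inverse bij_one bij_V bij_mul.
Proof. by move=> a; apply: bijP => x /=; rewrite bij_invK. Qed.

HB.instance Definition _ :=
  isGroup.Build (bij T) bij_mulA bij_mul1 bij_mulr1 bij_mulV bij_mulgV.

Lemma bij1E x : (1 : bij T) x = x. Proof. by []. Qed.
Lemma bijME (a b : bij T) x : (a * b) x = a (b x). Proof. by []. Qed.
Lemma bijKV (a : bij T) x : a^-1 (a x) = x. Proof. exact: bij_funK. Qed.
Lemma bijVK (a : bij T) x : a (a^-1 x) = x. Proof. exact: bij_invK. Qed.

End BijGroup.

(** The universal property of a free abelian group speaks of multiplicative
    groups; this copy of an additive group makes it applicable to coordinates. *)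
Definition mulgroup (Z : zmodType) : Type := Z.

Section MulGroup.
Variable Z : zmodType.
HB.instance Definition _ := Choice.on (mulgroup Z).
HB.instance Definition _ := isGroup.Build (mulgroup Z)
  (@addrA Z) (@add0r Z) (@addr0 Z) (@addNr Z) (@addrN Z).
Lemma mulgroup_abelian : abelian_group (mulgroup Z).
Proof. by move=> a b; exact: (@addrC Z). Qed.
End MulGroup.

Section IntegerPowers.
Variable G : groupType.
Implicit Types (x y : G) (z : int).

Definition zexp x z : G :=
  match z with Posz n => x ^+ n | Negz n => x ^- n.+1 end.

Lemma zexpS x z : zexp x (1 + z)%R = x * zexp x z.
Proof.
case: z => [n|[|n]] /=; first by rewrite add1n expgS.
  by rewrite mulgV.
by rewrite subn1 [in RHS]expgSr invgM mulVKg.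
Qed.

Lemma zexpD x z z' : zexp x (z + z')%R = zexp x z * zexp x z'.
Proof.
have N (t : int) : zexp x (-1 + t)%R = x^-1 * zexp x t.
  by rewrite -[in RHS](addrNK 1%R t) [in RHS]addrC zexpS mulKg addrC.
elim/int_rect: z => [|n IH|n IH]; first by rewrite add0r mul1g.
  by rewrite intS -addrA !zexpS IH mulgA.
by rewrite intS opprD -addrA !N IH mulgA.
Qed.

Lemma zexp1 x : zexp x 1%R = x. Proof. by []. Qed.
Lemma zexp0 x : zexp x 0%R = 1. Proof. by []. Qed.

Lemma zexpN x z : zexp x (- z)%R = (zexp x z)^-1.
Proof. by apply: (mulIg (zexp x z)); rewrite -zexpD addNr mulVg. Qed.

Lemma zexp_ind (P : G -> Prop) x z :
  P 1 -> (forall g, P g -> P (x * g)) -> (forall g, P g -> P (x^-1 * g)) ->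
  P (zexp x z).
Proof.
move=> P1 Px Pv; elim/int_rect: z => [//|n IH|n IH].
  by rewrite intS zexpS; exact: Px.
by rewrite intS opprD zexpD; exact: Pv.
Qed.

Lemma zexp_conj h x z : zexp (h * x * h^-1) z = h * zexp x z * h^-1.
Proof.
elim/int_rect: z => [|i IH|i IH]; first by rewrite !zexp0 mulg1 mulgV.
  by rewrite intS !zexpS IH !mulgA mulgVK.
rewrite intS opprD !zexpD IH !zexpN !zexp1 !invgM invgK !mulgA.
by rewrite mulgVK.
Qed.

Lemma cyclic_generatorE x g : cyclic_generator x -> exists z, g = zexp x z.
Proof.
case/(_ g) => n [->|->]; first by exists (Posz n).
by exists (- Posz n)%R; rewrite zexpN.
Qed.
End IntegerPowers.

Section GroupMorphism.
Variables (G H : groupType) (f : {multiplicative G -> H}).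

Lemma gmorph1 : f 1 = 1.
Proof. by apply: (mulgI (f 1)); rewrite -gmulfM !mulg1. Qed.

Lemma gmorphV x : f x^-1 = (f x)^-1.
Proof. by apply: (mulgI (f x)); rewrite -gmulfM !mulgV gmorph1. Qed.

Lemma gmorph_zexp x z : f (zexp x z) = zexp (f x) z.
Proof.
have fX n : f (x ^+ n) = f x ^+ n.
  by elim: n => [|n IH]; rewrite ?gmorph1 // !expgS gmulfM IH.
by case: z => n /=; rewrite ?gmorphV fX.
Qed.
End GroupMorphism.

(** * Free groups and free abelian groups are generated by their bases *)

Record subgroup (G : groupType) := Subgroup {
  sg_pred : {pred G};
  sg_closed : group_closed sg_pred }.

Section SubgroupType.
Variables (G : groupType) (H : subgroup G).

Definition sg_type : Type := {x : G | x \in sg_pred H}.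
HB.instance Definition _ := SubChoice.on sg_type.
HB.instance Definition _ :=
  SubChoice_isSubGroup.Build G (sg_pred H) sg_type (sg_closed H).
End SubgroupType.

(** The universal property gives a homomorphism from [F] to the subgroup defined
    by [P] that fixes the basis; followed by the inclusion it is the identity, by
    uniqueness. *)
Lemma free_basis_ind (F : groupType) n (x : 'I_n -> F) (P : F -> Prop) :
  free_basis x -> P 1 -> (forall a b, P a -> P b -> P (a * b)) ->
  (forall a, P a -> P a^-1) -> (forall j, P (x j)) -> forall f, P f.
Proof.
move=> xfree P1 PM PV Px f.
have Pc : group_closed [pred a : F | `[< P a >]].
  split=> [|a b]; rewrite !inE; first exact/asboolP.
  by move=> /asboolP Pa /asboolP Pb; apply/asboolP/PM => //; exact: PV.
pose H : groupType := sg_type (Subgroup Pc).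
have Hx j : x j \in sg_pred (Subgroup Pc) by rewrite !inE; exact/asboolP.
have [phi phix _] := xfree H (fun j => exist _ (x j) (Hx j)).
have [id0 _ uniq0] := xfree F x.
have E1 : [eta idfun] =1 id0 by apply: (uniq0 idfun).
have E2 : val \o phi =1 id0.
  by apply: (uniq0 (val \o phi)) => j /=; rewrite phix.
have -> : f = val (phi f) by exact: etrans (E1 f) (esym (E2 f)).
by have := valP (phi f); rewrite inE => /asboolP.
Qed.

(** An element with zero coordinates is trivial because the endomorphism that
    rebuilds an element from its coordinates fixes the basis, hence is the
    identity. *)
Lemma free_abelian_basis_coord (K : groupType) n (x : 'I_n -> K) :
  abelian_group K -> free_abelian_basis x ->
  exists c : {multiplicative K -> mulgroup 'rV[int]_n},
    (forall j, c (x j) = delta_mx 0%R j) /\ forall g, c g = 0%R -> g = 1.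
Proof.
move=> Kab xfree.
have [c cx _] := xfree _ (fun j => delta_mx 0%R j : mulgroup 'rV[int]_n)
  (@mulgroup_abelian _).
exists c; split=> // g cg0.
pose back (v : 'rV[int]_n) := \prod_(j < n) zexp (x j) (v 0%R j).
have backM : {morph (fun h => back (c h)) : a b / a * b}.
  move=> a b; rewrite /back -prodgM_commute => [|i j _ _]; last exact: Kab.
  by apply: eq_bigr => j _; rewrite gmulfM -zexpD; congr zexp; exact: mxE.
pose backc : {multiplicative K -> K} :=
  HB.pack (fun h => back (c h)) (isMultiplicative.Build K K _ backM).
have [id0 _ uniq0] := xfree K x Kab.
have E1 : [eta idfun] =1 id0 by apply: (uniq0 idfun).
have E2 : backc =1 id0.
  apply: uniq0 => j; rewrite -[backc _]/(back (c (x j))) cx /back.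
  rewrite (eq_bigr (fun i => if i == j then x j else 1)) => [|i _].
    by rewrite -big_mkcond big_pred1_eq.
  by rewrite mxE eqxx; case: eqP => [->|].
have -> : g = backc g by exact: etrans (E1 g) (esym (E2 g)).
by rewrite /= cg0 /back big1 // => j _; rewrite mxE.
Qed.

(** * The universal property of the fundamental group *)

Section FreeProductExt.
Variables (I : choiceType) (A : I -> groupType) (H : groupType).
Variable h : forall i, {multiplicative A i -> H}.

Definition word_val (u : word A) : H := \prod_(l <- u) h (tag l) (tagged l).

Lemma word_val_eq u v : word_eq u v -> word_val u = word_val v.
Proof.
elim=> {u v} [//|//|u v w _ -> //|u u' v v' _ uu' _ vv'|i|i a b].
- by rewrite /word_val !big_cat -/(word_val _) uu' -/(word_val v) vv'.
- by rewrite /word_val big_seq1 big_nil gmorph1.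
- by rewrite /word_val big_cons !big_seq1 /= gmulfM.
Qed.

Definition freeprod_ext (x : freeprod A) : H := word_val (repr x).

Lemma freeprod_ext_word u : freeprod_ext (fp_word u) = word_val u.
Proof. exact/word_val_eq/fp_repr. Qed.

Lemma freeprod_extM : {morph freeprod_ext : x y / x * y}.
Proof.
move=> x y; rewrite -(fp_wordK x) -(fp_wordK y) [X in freeprod_ext X]fp_mulE.
by rewrite !freeprod_ext_word /word_val big_cat.
Qed.
HB.instance Definition _ :=
  isMultiplicative.Build (freeprod A) H freeprod_ext freeprod_extM.

Lemma freeprod_ext_inj i (a : A i) : freeprod_ext (fp_inj a) = h i a.
Proof. by rewrite freeprod_ext_word /word_val big_seq1. Qed.
End FreeProductExt.

Lemma freeprod_ind (I : choiceType) (A : I -> groupType) (P : freeprod A -> Prop) :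
  P 1 -> (forall i (a : A i) x, P x -> P (fp_inj a * x)) -> forall x, P x.
Proof.
move=> P1 PM x; rewrite -(fp_wordK x); elim: (repr x) => [//|[i a] u IH].
by have := PM i a _ IH; rewrite [fp_inj a * _]fp_mulE.
Qed.

Section QuotientExt.
Variables (G H : groupType) (S : G -> Prop) (h : {multiplicative G -> H}).
Hypothesis hS : forall x, S x -> h x = 1.

Lemma normal_closure_ker x : normal_closure S x -> h x = 1.
Proof.
elim=> {x} [x /hS //||x y _ hx _ hy|x _ hx|x y _ hx].
- exact: gmorph1.
- by rewrite gmulfM hx hy mulg1.
- by rewrite gmorphV hx invg1.
- by rewrite /conjg !gmulfM hx mul1g gmorphV mulVg.
Qed.

Definition nquot_ext (x : nquot S) : H := h (repr x).

Lemma nquot_ext_pi x : nquot_ext (nquot_pi S x) = h x.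
Proof.
have := normal_closure_ker (nquot_repr S x); rewrite gmulfM gmorphV => E.
by apply: (mulgI (h (repr (nquot_pi S x)))^-1); rewrite E mulVg.
Qed.

Lemma nquot_extM : {morph nquot_ext : x y / x * y}.
Proof.
move=> x y; rewrite -(nquot_piK x) -(nquot_piK y) -nquot_piM.
by rewrite !nquot_ext_pi gmulfM.
Qed.
End QuotientExt.

Section StarPi1.
Variables (m : nat) (GG : star_of_groups m).

Definition of_center (f : center GG) : star_pi1 GG :=
  nquot_pi (edge_relator (GG := GG)) (in_center f).
Definition of_leaf i (x : leaf GG i) : star_pi1 GG :=
  nquot_pi (edge_relator (GG := GG)) (in_leaf x).

Lemma of_centerM : {morph of_center : x y / x * y}.
Proof. by move=> x y; rewrite /of_center -nquot_piM -gmulfM. Qed.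
Lemma of_leafM i : {morph @of_leaf i : x y / x * y}.
Proof. by move=> x y; rewrite /of_leaf -nquot_piM -gmulfM. Qed.
HB.instance Definition _ := isMultiplicative.Build (center GG) (star_pi1 GG)
  of_center of_centerM.
HB.instance Definition _ i := isMultiplicative.Build (leaf GG i) (star_pi1 GG)
  (@of_leaf i) (@of_leafM i).

Lemma of_edge i (g : edge GG i) : of_center (alpha GG i g) = of_leaf (omega GG i g).
Proof.
apply/nquot_piP; set a := in_center _; set b := in_leaf _.
have -> : a^-1 * b = (a * b^-1)^-1 ^ a.
  by rewrite /conjg invgM invgK mulgVK.
apply/normal_closure_conj/normal_closure_inv/normal_closure_gen.
by exists i, g.
Qed.

Lemma star_pi1_ind (P : star_pi1 GG -> Prop) :
  P 1 -> (forall f x, P x -> P (of_center f * x)) ->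
  (forall i (a : leaf GG i) x, P x -> P (of_leaf a * x)) -> forall x, P x.
Proof.
move=> P1 Pc Pl x; rewrite -(nquot_piK x).
elim/freeprod_ind: (repr x) => [|[i|] a y Py]; first exact: P1.
- by rewrite nquot_piM; exact: Pl.
- by rewrite nquot_piM; exact: Pc.
Qed.

Lemma star_pi1_ext (H : groupType) (hc : {multiplicative center GG -> H})
    (hl : forall i, {multiplicative leaf GG i -> H}) :
  (forall i g, hc (alpha GG i g) = hl i (omega GG i g)) ->
  exists h : {multiplicative star_pi1 GG -> H},
    (forall f, h (of_center f) = hc f) /\
    (forall i x, h (of_leaf (i := i) x) = hl i x).
Proof.
move=> hE.
pose hv (v : option 'I_m) : {multiplicative vertex_group GG v -> H} :=
  match v with None => hc | Some i => hl i end.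
have Ec f : freeprod_ext hv (in_center f) = hc f.
  exact: (freeprod_ext_inj hv (i := None)).
have El i x : freeprod_ext hv (in_leaf x) = hl i x.
  exact: (freeprod_ext_inj hv (i := Some i)).
have hS x : edge_relator x -> freeprod_ext hv x = 1.
  by move=> [i [g ->]]; rewrite gmulfM gmorphV /= Ec El hE mulgV.
have hM := nquot_extM hS.
pose h : {multiplicative star_pi1 GG -> H} :=
  HB.pack (nquot_ext (freeprod_ext hv)) (isMultiplicative.Build _ H _ hM).
exists h.
split=> [f|i x]; first exact: etrans (nquot_ext_pi hS _) (Ec f).
exact: etrans (nquot_ext_pi hS _) (El i x).
Qed.
End StarPi1.

Local Open Scope group_scope.

(** * Linear isometries *)

Section Isometry.
Variables (V : lmodType int) (B : V -> V -> int).

Definition isometric (a : bij V) : Prop :=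
  linear a /\ forall v w, B (a v) (a w) = B v w.

Lemma isometric0 a : isometric a -> a 0%R = 0%R.
Proof.
by move=> [la _]; have := la (-1)%R 0%R 0%R; rewrite scaler0 addr0 scaleN1r addNr.
Qed.

Lemma form_left0 :
  (forall k u v w, B (k *: u + v)%R w = (k * B u w + B v w)%R) ->
  forall w, B 0%R w = 0%R.
Proof.
by move=> BP w; have := BP (-1)%R 0%R 0%R w; rewrite scaler0 addr0 mulN1r addNr.
Qed.

Lemma isometric1 : isometric 1. Proof. by []. Qed.

Lemma isometricM a b : isometric a -> isometric b -> isometric (a * b).
Proof.
move=> [la Ba] [lb Bb]; split=> [k v w|v w]; rewrite !bijME ?lb ?la //.
by rewrite Ba Bb.
Qed.

Lemma isometricV a : isometric a -> isometric a^-1.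
Proof.
move=> [la Ba]; split=> [k v w|v w]; last by rewrite -Ba !bijVK.
by apply: (can_inj (bijKV a)); rewrite la !bijVK.
Qed.

End Isometry.

(** * Words in a free group *)

Section Words.
Variables (F : groupType) (n : nat) (x : 'I_n -> F).
Hypothesis xfree : free_basis x.

(** The letter [(j, b)] stands for [x j] if [b] holds and for its inverse
    otherwise. *)
Definition gletter : Type := ('I_n * bool)%type.
Definition linv (a : gletter) : gletter := (a.1, ~~ a.2).
Definition lval (a : gletter) : F := if a.2 then x a.1 else (x a.1)^-1.
Definition wval (s : seq gletter) : F := \prod_(a <- s) lval a.
Definition nocancel : rel gletter := fun a b => b != linv a.

Lemma linvK : involutive linv.
Proof. by case=> j b; rewrite /linv /= negbK. Qed.

Lemma lval_linv a : lval (linv a) = (lval a)^-1.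
Proof. by case: a => j [] /=; rewrite /lval //= invgK. Qed.

Lemma wval_cons a s : wval (a :: s) = lval a * wval s.
Proof. exact: big_cons. Qed.

Lemma wval_cat s t : wval (s ++ t) = wval s * wval t.
Proof. exact: big_cat. Qed.

Lemma wval1 a : wval [:: a] = lval a. Proof. exact: big_seq1. Qed.

Lemma reduced_word f : exists2 s, f = wval s & sorted nocancel s.
Proof.
have mulP a g : (exists2 s, g = wval s & sorted nocancel s) ->
    exists2 s, lval a * g = wval s & sorted nocancel s.
  case=> -[|b s] -> rs; first by exists [:: a]; rewrite ?wval_cons.
  have [ab|ab] := eqVneq b (linv a).
    exists s; last exact: path_sorted rs.
    by rewrite wval_cons ab lval_linv mulVKg.
  by exists [:: a, b & s]; rewrite ?wval_cons //= {1}/nocancel ab.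
suff: exists s, f = wval s.
  case=> s ->; elim: s => [|a s IH]; first by exists [::].
  by rewrite wval_cons; exact: mulP.
move: f; apply: (@free_basis_ind F n x (fun f => exists s, f = wval s) xfree) =>
  [|f g [s ->] [t ->]|f [s ->]|j].
- by exists [::]; rewrite /wval big_nil.
- by exists (s ++ t); rewrite wval_cat.
- exists (rev (map linv s)); elim: s => [|a s IH].
    by rewrite /wval big_nil invg1.
  by rewrite wval_cons /= rev_cons -cats1 wval_cat -IH wval1 lval_linv invgM.
- by exists [:: (j, true)]; rewrite wval1.
Qed.

(** As long as the first and the last letter of a reduced word cancel,
    conjugation by the first letter removes both of them. *)
Lemma cyclically_reduced_conj u : u <> 1 ->
  exists (s : seq gletter) (h : F),
    [/\ s != [::], cycle nocancel s & u = h * wval s * h^-1].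
Proof.
have [s us rs] := reduced_word u; move=> u1.
have s0 : s != [::].
  by apply/eqP => s0; apply: u1; rewrite us s0 /wval big_nil.
have {us} : u = 1 * wval s * 1^-1 by rewrite mul1g invg1 mulg1.
elim: {s}(size s) {-2}s (leqnn (size s)) 1 rs s0 => [|N IH] s sN h rs s0 us.
  by case: s sN s0 {rs us}.
case: s sN rs s0 us => // a p sN rs _ us.
have [ca|ca] := boolP (nocancel (last a p) a).
  by exists (a :: p), h; split=> //=; rewrite rcons_path ca andbT.
case/lastP: p sN rs us ca => [|p b] sN rs us.
  by case: {rs us sN} a => j b; rewrite /nocancel /= negbK => /eqP [] /eqP; case: b.
rewrite last_rcons negbK => /eqP ab.
apply: (IH p _ (h * lval a)).
- by move: sN; rewrite /= size_rcons; lia.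
- by move: rs; rewrite /= rcons_path => /andP [/path_sorted].
- by apply/eqP => p0; move: rs; rewrite p0 /= {1}/nocancel ab linvK eqxx.
- rewrite us wval_cons -cats1 wval_cat wval1 ab lval_linv.
  by rewrite !invgM invgK !mulgA.
Qed.
End Words.

(** One prescribed value is added at a time: the permutation found for the
    other pairs is corrected by a transposition. *)
Lemma perm_extend (T : finType) (ps : seq (T * T)) :
  uniq (map fst ps) -> uniq (map snd ps) ->
  exists s : {perm T}, forall p, p \in ps -> s p.1 = p.2.
Proof.
elim: ps => [|[a b] ps IH] /=; first by exists 1.
move=> /andP [na u1] /andP [nb u2]; have [s sP] := IH u1 u2.
exists (s * tperm (s a) b) => p; rewrite inE permM => /orP [/eqP -> /=|pp].
  by rewrite tpermL.
rewrite (sP _ pp) tpermD //; last by apply: contraNneq nb => ->; exact: map_f.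
rewrite -(sP _ pp) (inj_eq perm_inj).
by apply: contraNneq na => ->; exact: map_f.
Qed.

Local Open Scope ring_scope.

(** * Binary quadratic forms *)

(** The quadruple [(c, a, b, d)] is a constant [c] together with the symmetric
    matrix with rows [a, b] and [b, d].  A matrix [g] of determinant 1 or -1 acts on
    the second component by [S -> g S g^T] and preserves the polarized
    determinant, which [qdot] subtracts from the product of the constants. *)
Definition qform : Type := (int^o * int^o * int^o * int^o)%type.
HB.instance Definition _ := Vector.on qform.

Definition qmk (c a b d : int) : qform := (c, a, b, d).

(** The symmetric matrix [v v^T] of the column [v = (x, y)], with constant 1; it
    determines [v] up to sign. *)
Definition qsq (x y : int) : qform := qmk 1 (x * x) (x * y) (y * y).

Definition qdot (v w : qform) : int :=
  let: (c, a, b, d) := v in let: (c', a', b', d') := w in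
  c * c' - (a * d' - 2 * (b * b') + d * a').

(** The action of the matrix with rows [1, 2 k] and [0, 1]. *)
Definition qshift_fun (k : int) (v : qform) : qform :=
  let: (c, a, b, d) := v in
  qmk c (a + 4 * k * b + 4 * k * k * d) (b + 2 * k * d) d.

(** The action of the matrix with rows [0, -1] and [1, 0]. *)
Definition qflip_fun (v : qform) : qform :=
  let: (c, a, b, d) := v in qmk c d (- b) a.

Lemma qmk_eq c a b d c' a' b' d' :
  c = c' -> a = a' -> b = b' -> d = d' -> qmk c a b d = qmk c' a' b' d'.
Proof. by move=> -> -> -> ->. Qed.

Lemma qshift_funD k l v : qshift_fun k (qshift_fun l v) = qshift_fun (k + l) v.
Proof. case: v => [[[c a] b] d] /=; apply: qmk_eq => //; ring. Qed.

Lemma qshift_fun0 v : qshift_fun 0 v = v.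
Proof. case: v => [[[c a] b] d] /=; apply: qmk_eq => //; ring. Qed.

Lemma qshiftK k : cancel (qshift_fun k) (qshift_fun (- k)).
Proof. by move=> v; rewrite qshift_funD addNr qshift_fun0. Qed.

Lemma qshiftVK k : cancel (qshift_fun (- k)) (qshift_fun k).
Proof. by move=> v; rewrite qshift_funD addrN qshift_fun0. Qed.

Lemma qflipK : involutive qflip_fun.
Proof. case=> [[[c a] b] d] /=; apply: qmk_eq => //; ring. Qed.

Definition qshift k : bij qform := Bij (qshiftK k) (qshiftVK k).
Definition qflip : bij qform := Bij qflipK qflipK.

Lemma qshiftD k l : qshift (k + l) = (qshift k * qshift l)%g.
Proof. by apply: bijP => v; rewrite bijME /= qshift_funD. Qed.

Lemma qshiftN k : qshift (- k) = (qshift k)^-1%g.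
Proof. by apply: bijP. Qed.

Lemma qflipV : qflip^-1%g = qflip. Proof. exact: bijP. Qed.

Lemma qshift0 : qshift 0 = 1%g. Proof. by apply: bijP => v; exact: qshift_fun0. Qed.

Lemma qshift_iso k : isometric qdot (qshift k).
Proof.
split=> [l|] [[[c a] b] d] [[[c' a'] b'] d'] /=; last by rewrite /qdot /=; ring.
by apply: qmk_eq; rewrite /= /GRing.scale /=; ring.
Qed.

Lemma qflip_iso : isometric qdot qflip.
Proof.
split=> [l|] [[[c a] b] d] [[[c' a'] b'] d'] /=; last by rewrite /qdot /=; ring.
by apply: qmk_eq; rewrite /= /GRing.scale /=; ring.
Qed.

Lemma qshift_sq k x y : qshift k (qsq x y) = qsq (x + 2 * k * y) y.
Proof. by apply: qmk_eq; ring. Qed.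

Lemma qflip_sq x y : qflip (qsq x y) = qsq (- y) x.
Proof. by apply: qmk_eq; ring. Qed.

(** The source of the inequality in [cyclic_separation]: for a matrix with first
    column [(x, y)] the value is positive only if [y] vanishes. *)
Lemma qdot_sq x y : qdot (qsq 1 0) (qsq x y) = 1 - y * y.
Proof. by rewrite /qdot /=; ring. Qed.

Lemma qdotC v w : qdot v w = qdot w v.
Proof.
case: v w => [[[c a] b] d] [[[c' a'] b'] d']; rewrite /qdot; ring.
Qed.

Lemma qdotP k u v w : qdot (k *: u + v) w = k * qdot u w + qdot v w.
Proof.
case: u v w => [[[c a] b] d] [[[c' a'] b'] d'] [[[c2 a2] b2] d2].
by rewrite /qdot /= /GRing.scale /=; ring.
Qed.

(** * Monomial isometries of a sum of copies *)

Section Monomial.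
Variable T : finType.

Definition lattice : Type := {ffun T -> qform}.
HB.instance Definition _ := Vector.on lattice.

Definition ldot (u v : lattice) : int := \sum_t qdot (u t) (v t).

Lemma ldotC u v : ldot u v = ldot v u.
Proof. by apply: eq_bigr => t _; exact: qdotC. Qed.

Lemma ldotP k u v w : ldot (k *: u + v) w = k * ldot u w + ldot v w.
Proof.
rewrite /ldot mulr_sumr -big_split; apply: eq_bigr => t _.
by rewrite !ffunE qdotP.
Qed.

Definition single (t : T) (q : qform) : lattice := [ffun s => if s == t then q else 0].

Lemma qdot0 v : qdot 0 v = 0.
Proof. exact: form_left0 qdotP v. Qed.

Lemma ldot_single t s p q :
  ldot (single t p) (single s q) = if t == s then qdot p q else 0.
Proof.
rewrite /ldot (bigD1 t) //= big1 => [|r /negbTE rt]; last by rewrite !ffunE rt qdot0.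
by rewrite !ffunE eqxx addr0; case: eqP => // _; rewrite qdotC qdot0.
Qed.

Lemma single_inj t p q : single t p = single t q -> p = q.
Proof. by move/ffunP/(_ t); rewrite !ffunE eqxx. Qed.

Section Generator.
Variables (s : {perm T}) (mu : T -> bij qform).

Definition mono_fun (v : lattice) : lattice :=
  [ffun t => mu ((s^-1)%g t) (v ((s^-1)%g t))].
Definition mono_inv (v : lattice) : lattice :=
  [ffun t => (mu t)^-1%g (v (s t))].

Lemma mono_funK : cancel mono_fun mono_inv.
Proof. by move=> v; apply/ffunP => t; rewrite !ffunE permK bijKV. Qed.
Lemma mono_invK : cancel mono_inv mono_fun.
Proof. by move=> v; apply/ffunP => t; rewrite !ffunE permKV bijVK. Qed.
Definition mono : bij lattice := Bij mono_funK mono_invK.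

Hypothesis mu_iso : forall t, isometric qdot (mu t).

Lemma mono_iso : isometric ldot mono.
Proof.
split=> [k u v|u v].
  by apply/ffunP => t; rewrite !ffunE; have [-> _] := mu_iso ((s^-1)%g t).
rewrite /ldot [RHS](reindex_inj (@perm_inj _ (s^-1)%g)); apply: eq_bigr => t _.
by rewrite !ffunE; have [_ ->] := mu_iso ((s^-1)%g t).
Qed.

Lemma mono_single t q : mono (single t q) = single (s t) (mu t q).
Proof.
apply/ffunP => r; rewrite !ffunE (canF_eq (permKV s)).
by case: eqP => [->|_]; rewrite ?permK ?(isometric0 (mu_iso _)).
Qed.

Lemma mono_inv_single t q :
  mono^-1%g (single t q) = single ((s^-1)%g t) ((mu ((s^-1)%g t))^-1%g q).
Proof. by apply: (can_inj (bijKV mono)); rewrite bijVK mono_single bijVK permKV. Qed.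
End Generator.
End Monomial.

Local Open Scope group_scope.

(** * The loop of a cyclically reduced word *)

Section Loop.
Variables (n l : nat) (a0 : gletter n) (p : seq (gletter n)).
(* The word is split as a0 :: p because a0 also serves as default letter. *)
Let s := a0 :: p.
Let k := size s.
Hypothesis s_cycle : cycle (@nocancel n) s.
Hypothesis k_le_l : (k <= l.+1)%N.

Local Notation vertex := 'I_l.+1.
Local Notation y t := (nth a0 s t).

Let k_gt0 : (0 < k)%N. Proof. by []. Qed.

(** The [t]-th letter leads from vertex [t + 1] to vertex [t], indices being taken
    modulo the length: with a left action the last letter of a word acts first. *)
Definition loop_vertex (t : nat) : vertex := inord (t %% k).
Local Notation vtx := loop_vertex.

Lemma loop_vertex_eq t t' : vtx t = vtx t' -> t = t' %[mod k].
Proof.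
have lt i : (i %% k < l.+1)%N by apply: leq_trans k_le_l; rewrite ltn_pmod.
by move/(congr1 val); rewrite /= !inordK.
Qed.

Lemma loop_vertex_inj t t' : (t < k)%N -> (t' < k)%N -> vtx t = vtx t' -> t = t'.
Proof. by move=> tk tk' /loop_vertex_eq; rewrite !modn_small. Qed.

Lemma loop_vertex_injS t t' :
  (t < k)%N -> (t' < k)%N -> vtx t.+1 = vtx t'.+1 -> t = t'.
Proof.
move=> tk tk' /loop_vertex_eq /eqP; rewrite -(addn1 t) -(addn1 t') eqn_modDr => /eqP.
by rewrite !modn_small.
Qed.

(** This is where cyclic reduction enters: no generator is asked to leave a vertex,
    or to reach it, along two different edges of the loop. *)
Lemma loop_nocancel t t' : (t < k)%N -> (t' < k)%N ->
  vtx t.+1 = vtx t' -> y t' <> linv (y t).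
Proof.
move=> tk tk' /loop_vertex_eq; rewrite [in RHS]modn_small // => <- /eqP.
apply/negP; move: s_cycle => /(pathP a0) /(_ t).
rewrite size_rcons => /(_ tk).
have -> : nth a0 (a0 :: rcons p a0) t = y t.
  by rewrite -rcons_cons nth_rcons tk.
congr (~~ (_ == _)); rewrite nth_rcons.
have [tp|] := ltnP t (size p); first by rewrite modn_small.
move=> pt; have -> : t = size p by apply/eqP; rewrite eqn_leq pt -ltnS tk.
by rewrite eqxx modnn.
Qed.

Definition loop_pair (t : nat) : vertex * vertex :=
  if (y t).2 then (vtx t.+1, vtx t) else (vtx t, vtx t.+1).
Definition loop_pairs (j : 'I_n) : seq (vertex * vertex) :=
  [seq loop_pair t | t <- iota 0 k & (y t).1 == j].

Lemma loop_pairs_uniq j :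
  uniq (map fst (loop_pairs j)) /\ uniq (map snd (loop_pairs j)).
Proof.
have mem t : t \in [seq t <- iota 0 k | (y t).1 == j] -> (t < k)%N /\ (y t).1 = j.
  by rewrite mem_filter mem_iota => /andP [/eqP ? /andP [_ ?]].
have u : uniq [seq t <- iota 0 k | (y t).1 == j] by rewrite filter_uniq ?iota_uniq.
have opp t t' : (y t).1 = j -> (y t').1 = j -> (y t).2 = ~~ (y t').2 ->
    y t = linv (y t').
  by rewrite [y t]surjective_pairing /linv /= => -> -> ->.
split; rewrite -map_comp map_inj_in_uniq // => t t' /mem [tk jt] /mem [tk' jt'];
  rewrite /loop_pair /=.
- case bt: (y t).2; case bt': (y t').2 => /=; last exact: loop_vertex_inj.
  + exact: loop_vertex_injS.
  + by move/(loop_nocancel tk tk') => []; apply: opp => //; rewrite bt bt'.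
  + by move/esym/(loop_nocancel tk' tk) => []; apply: opp => //; rewrite bt bt'.
- case bt: (y t).2; case bt': (y t').2 => /=; first exact: loop_vertex_inj.
  + by move/esym/(loop_nocancel tk' tk) => []; apply: opp => //; rewrite bt bt'.
  + by move/(loop_nocancel tk tk') => []; apply: opp => //; rewrite bt bt'.
  + exact: loop_vertex_injS.
Qed.

Definition loop_perm_spec j : {g : {perm vertex} | forall t : 'I_k,
  (y t).1 = j -> g (loop_pair t).1 = (loop_pair t).2}.
Proof.
apply: cid; have [u1 u2] := loop_pairs_uniq j.
have [g gP] := perm_extend u1 u2; exists g => t jt; apply: gP.
by apply: map_f; rewrite mem_filter jt eqxx mem_iota ltn_ord.
Qed.
Definition loop_perm j : {perm vertex} := sval (loop_perm_spec j).

Lemma loop_perm_true t j : (t < k)%N -> y t = (j, true) ->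
  loop_perm j (vtx t.+1) = vtx t.
Proof.
move=> tk yt; have := svalP (loop_perm_spec j) (Ordinal tk).
by rewrite /loop_pair /= yt; apply.
Qed.

Lemma loop_perm_false t j : (t < k)%N -> y t = (j, false) ->
  loop_perm j (vtx t) = vtx t.+1.
Proof.
move=> tk yt; have := svalP (loop_perm_spec j) (Ordinal tk).
by rewrite /loop_pair /= yt; apply.
Qed.

(** Offsets are half of the even integers [p] and [q] described at the top: the
    edge with number [i] has the offsets [2 i] and [2 i + 1], all of them smaller than
    the shift [M] along an edge of the loop. *)
Definition big_shift : int := (2 * #|{: vertex * 'I_n}|)%N%:Z.
Local Notation M := big_shift.

Definition offset (b : bool) (e : vertex * 'I_n) : int := (2 * enum_rank e + b)%N%:Z.

Lemma offset_ge0 b e : (0 <= offset b e)%R. Proof. by []. Qed.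

Lemma offset_lt b e : (offset b e < M)%R.
Proof. rewrite /offset /big_shift ltz_nat; case: (enum_rank e) => i /=.
by move: #|_| => N; case: b; lia. Qed.

Lemma offset_inj b e b' e' : offset b e = offset b' e' -> b = b' /\ e = e'.
Proof.
rewrite /offset => - [E].
suff [-> /ord_inj/enum_rank_inj //] : b = b' /\ enum_rank e = enum_rank e' :> nat.
by case: b b' E => [] [] /= E; split=> //; lia.
Qed.

Definition loop_label (j : 'I_n) (w : vertex) : bij qform :=
  if [exists t : 'I_k, (y t == (j, true)) && (w == vtx t.+1)] then qshift M
  else if [exists t : 'I_k, (y t == (j, false)) && (w == vtx t)] then qshift (- M)%R
  else qshift (offset false (w, j)) * qflip * (qshift (offset true (w, j)))^-1.

Definition letter_step (a : gletter n) (w : vertex) : vertex :=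
  if a.2 then loop_perm a.1 w else (loop_perm a.1)^-1 w.
Definition letter_label (a : gletter n) (w : vertex) : bij qform :=
  if a.2 then loop_label a.1 w else (loop_label a.1 (letter_step a w))^-1.

(** For a letter that leaves the loop, [e] is the edge that it runs through.  Run
    backwards, an edge exchanges its two offsets; thus [offset (~~ a.2) e] belongs to
    the end of the step and [offset a.2 e] to its beginning. *)
Variant letter_spec (a : gletter n) (w : vertex) : vertex -> bij qform -> Prop :=
| LetterForth t of (t < k)%N & a = y t & w = vtx t.+1 :
    letter_spec a w (vtx t) (qshift M)
| LetterBack t of (t < k)%N & a = linv (y t) & w = vtx t :
    letter_spec a w (vtx t.+1) (qshift (- M)%R)
| LetterOff e w' of e.2 = a.1 : letter_spec a w w'
    (qshift (offset (~~ a.2) e) * qflip * qshift (- offset a.2 e)%R).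

Lemma letterP a w : letter_spec a w (letter_step a w) (letter_label a w).
Proof.
case: a => j []; rewrite /letter_label /letter_step /loop_label /=.
  case: existsP => [[t /andP [/eqP yt /eqP ->]]|_].
    by rewrite (loop_perm_true _ yt) //; exact: LetterForth.
  case: existsP => [[t /andP [/eqP yt /eqP ->]]|_].
    by rewrite (loop_perm_false _ yt) //; apply: LetterBack; rewrite ?yt.
  by rewrite -qshiftN; exact: (LetterOff (a := (j, true)) _ (e := (w, j))).
set w' := (loop_perm j)^-1 w; have ww' : w = loop_perm j w' by rewrite permKV.
case: existsP => [[t /andP [/eqP yt /eqP ew]]|_].
  rewrite -qshiftN ew; apply: LetterBack; rewrite ?yt //.
  by rewrite ww' ew (loop_perm_true _ yt).
case: existsP => [[t /andP [/eqP yt /eqP ew]]|_].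
  rewrite -qshiftN opprK ew; apply: LetterForth; rewrite ?yt //.
  by rewrite ww' ew (loop_perm_false _ yt).
rewrite !invgM invgK qflipV mulgA -qshiftN.
exact: (LetterOff (a := (j, false)) _ (e := (w', j))).
Qed.

Lemma loop_label_iso j w : isometric qdot (loop_label j w).
Proof.
rewrite /loop_label; case: ifP => _; first exact: qshift_iso.
case: ifP => _; first exact: qshift_iso.
apply: isometricM; last by apply: isometricV; exact: qshift_iso.
by apply: isometricM; [exact: qshift_iso|exact: qflip_iso].
Qed.

Section Action.
Variables (F : groupType) (x : 'I_n -> F).
Hypothesis xfree : free_basis x.
Variable act : {multiplicative F -> bij (lattice vertex)}.
Hypothesis act_basis : forall j, act (x j) = mono (loop_perm j) (loop_label j).

Local Notation u := (wval x s).
Local Notation base := (vtx 0).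

Lemma act_iso f : isometric (@ldot vertex) (act f).
Proof.
move: f; apply: (@free_basis_ind F n x (fun f => isometric (@ldot _) (act f)) xfree).
- by rewrite gmorph1; exact: isometric1.
- by move=> a b ia ib; rewrite gmulfM; exact: isometricM.
- by move=> a ia; rewrite gmorphV; exact: isometricV.
- by move=> j; rewrite act_basis; apply: mono_iso => t; exact: loop_label_iso.
Qed.

Lemma act_letter a w q :
  act (lval x a) (single w q) = single (letter_step a w) (letter_label a w q).
Proof.
case: a => j []; rewrite /lval /letter_step /letter_label /=.
  rewrite act_basis mono_single // => t; exact: loop_label_iso.
rewrite gmorphV act_basis mono_inv_single // => t; exact: loop_label_iso.
Qed.

Lemma letter_forth t : (t < k)%N ->
  letter_step (y t) (vtx t.+1) = vtx t /\ letter_label (y t) (vtx t.+1) = qshift M.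
Proof.
move=> tk; rewrite /letter_step /letter_label.
have [yt|yt] : y t = ((y t).1, true) \/ y t = ((y t).1, false).
  by case: (y t) => j []; [left|right].
- rewrite yt /= (loop_perm_true tk yt); split=> //; rewrite /loop_label.
  by case: existsP => // -[]; exists (Ordinal tk); rewrite /= {1}yt !eqxx.
- have E := loop_perm_false tk yt; rewrite yt /= /letter_step /= -E permK.
  split=> //; rewrite /loop_label; case: existsP => [[t' /andP [/eqP yt' /eqP e]]|_].
    by case: (@loop_nocancel t' t (ltn_ord t') tk (esym e)); rewrite yt yt'.
  case: existsP => [_|[]]; first by rewrite qshiftN invgK.
  by exists (Ordinal tk); rewrite /= {1}yt !eqxx.
Qed.

(** Reading a final segment of the cyclic word from the base vertex runs backwards
    along the loop, from vertex [k = 0] down to vertex [t]. *)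
Lemma act_drop t q : (t <= k)%N ->
  act (wval x (drop t s)) (single base q) =
  single (vtx t) (qshift (M * (k - t)%N%:Z)%R q).
Proof.
move=> tk; rewrite -(subKn tk) [in X in qshift X](subKn tk).
elim: (k - t)%N (leq_subr t k) => [|i IH] ik.
  rewrite subn0 drop_size /wval big_nil gmorph1 mulr0 qshift0 !bij1E.
  by congr single; rewrite /vtx modnn mod0n.
have lt : (k - i.+1 < k)%N by lia.
rewrite (drop_nth a0 lt) wval_cons gmulfM bijME -subSn // subSS IH; last by lia.
rewrite act_letter; have [] := letter_forth lt.
rewrite -[in vtx _]subSn // subSS => -> ->.
by rewrite -bijME -qshiftD intS mulrDr mulr1.
Qed.

Lemma act_loop z q : act (zexp u z) (single base q) =
  single base (qshift (M * k%:Z * z)%R q).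
Proof.
have E r : act u (single base r) = single base (qshift (M * k%:Z)%R r).
  by have := @act_drop 0 r isT; rewrite drop0 subn0.
elim/int_rect: z => [|i IH|i IH].
- by rewrite gmorph1 mulr0 qshift0.
- by rewrite intS zexpS gmulfM bijME IH E -bijME -qshiftD mulrDr mulr1.
- apply: (can_inj (bijKV (act u))); rewrite E -bijME -gmulfM -zexpS -bijME -qshiftD.
  rewrite (_ : 1 + - (i.+1)%:Z = - i%:Z)%R; last by lia.
  by rewrite IH; congr (single _ (qshift _ _)); lia.
Qed.

(** The state of a walk from the base vertex that has stayed on the loop: the
    element read so far is determined up to a power of [u] by the vertex reached,
    and the vector [(1, 0)] is fixed by all the shifts. *)
Definition on_loop (f : F) (w : vertex) (a b : int) : Prop :=
  [/\ exists t z, [/\ (t < k)%N, w = vtx t & f = wval x (drop t s) * zexp u z],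
      a = 1%R & b = 0%R].

(** The state of a walk that has left the loop.  Here [e] and [c] tell where the last
    step off the loop ended and [d] is the signed number of steps made on the loop
    since then; the last letter [hd] records the direction of these steps, which
    a reduced walk cannot change.  In terms of continued fractions, [z / b] is the
    tail of [a / b] and has absolute value less than 1. *)
Definition off_loop (hd : gletter n) (w : vertex) (a b : int) : Prop :=
  exists z d c e, [/\ `|z| < `|b|, a = z + 2 * (M * d + offset c e) * b &
    [\/ d = 0 /\ hd = (e.2, ~~ c),
        0 < d /\ (exists t, [/\ (t < k)%N, hd = y t & w = vtx t]) |
        d < 0 /\ (exists t, [/\ (t < k)%N, hd = linv (y t) & w = vtx t.+1])]]%R.

Lemma drop_forth t f : (t < k)%N ->
  lval x (y t) * (wval x (drop t.+1 s) * f) = wval x (drop t s) * f.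
Proof. by move=> tk; rewrite (drop_nth a0 tk) wval_cons mulgA. Qed.

Lemma on_loop_forth t f a b : (t < k)%N ->
  on_loop f (vtx t.+1) a b -> on_loop (lval x (y t) * f) (vtx t) a b.
Proof.
move=> tk [[t' [z [tk' wt' ->]]] -> ->]; split=> //.
exists t; have [lt|ge] := ltnP t.+1 k.
  exists z; split=> //.
  by rewrite -(loop_vertex_inj lt tk' wt') drop_forth.
have {ge} ek : t.+1 = k by apply/eqP; rewrite eqn_leq tk.
exists (1 + z)%R; split=> //; rewrite zexpS -(drop_forth _ tk) ek drop_size.
have -> : t' = 0%N.
  apply: (loop_vertex_inj tk' k_gt0); rewrite -wt' ek.
  by rewrite /loop_vertex modnn mod0n.
by rewrite drop0 [wval x [::]]big_nil mul1g.
Qed.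

Lemma on_loop_back t f a b : (t < k)%N ->
  on_loop f (vtx t) a b -> on_loop (lval x (linv (y t)) * f) (vtx t.+1) a b.
Proof.
move=> tk [[t' [z [tk' wt' ->]]] -> ->]; split=> //.
rewrite -(loop_vertex_inj tk tk' wt') lval_linv -(drop_forth _ tk) mulKg.
have [lt|ge] := ltnP t.+1 k; first by exists t.+1, z.
have {ge} ek : t.+1 = k by apply/eqP; rewrite eqn_leq tk.
exists 0%N, (- 1 + z)%R; rewrite ek drop_size drop0 zexpD zexpN zexp1 mulVKg.
by rewrite [wval x [::]]big_nil mul1g /loop_vertex modnn mod0n.
Qed.

(** One step of a continued fraction with partial quotient [2 c]. *)
Lemma shift_grow (z b c : int) : (`|z| < `|b| -> c != 0 -> `|b| < `|z + 2 * c * b|)%R.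
Proof.
move=> zb c0; have : (`|b| <= `|c * b|)%R.
  by rewrite normrM ler_peMl //; lia.
by rewrite -mulrA; move: (c * b)%R => w; lia.
Qed.

Lemma off_loop_new hd e w (a b : int) :
  e.2 = hd.1 -> (`|b| < `|a - 2 * offset hd.2 e * b|)%R ->
  exists a' b', [/\ (qshift (offset (~~ hd.2) e) * qflip * qshift (- offset hd.2 e)%R)
                     (qsq a b) = qsq a' b' & off_loop hd w a' b'].
Proof.
move=> eh lt; set a1 := (a - 2 * offset hd.2 e * b)%R in lt.
exists (- b + 2 * offset (~~ hd.2) e * a1)%R, a1.
rewrite !bijME qshift_sq qflip_sq qshift_sq.
have -> : (a + 2 * - offset hd.2 e * b = a1)%R by rewrite /a1; ring.
split=> //; exists (- b)%R, 0%R, (~~ hd.2), e; split; first by rewrite normrN.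
  by rewrite mulr0 add0r.
by constructor 1; split=> //; rewrite negbK eh -surjective_pairing.
Qed.

(** A partial quotient [c] of the continued fraction could only vanish if no step
    was made on the loop ([d = 0], as the offsets are small) and the offsets at both
    ends of the visit agree; then the step off the loop is undone at once, and the
    word is not reduced. *)
Lemma reduced_walk t : sorted (@nocancel n) t -> exists w a b,
  act (wval x t) (single base (qsq 1 0)) = single w (qsq a b) /\
  (on_loop (wval x t) w a b \/ off_loop (head a0 t) w a b /\ t <> [::]).
Proof.
elim: t => [_|a t IH rt].
  exists base, 1%R, 0%R; rewrite /wval big_nil gmorph1; split=> //; left.
  (* The base is vertex 0, where the final segment is all of u: 1 = u * u^-1. *)
  split=> //; exists 0%N, (- 1)%R; split=> //.
  by rewrite drop0 zexpN mulgV.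
have [w [a1 [b1 [E inv]]]] := IH (path_sorted rt).
rewrite wval_cons gmulfM bijME E act_letter.
have nca : t <> [::] -> a <> linv (head a0 t).
  case: t rt {IH E inv} => // b t /= /andP [/eqP ba _] _ ab.
  by apply: ba; rewrite ab linvK.
case: (letterP a w) => [t' tk ea ew|t' tk ea ew|e w' ea].
- exists (vtx t'), (a1 + 2 * M * b1)%R, b1; rewrite qshift_sq; split=> //.
  case: inv => [onl|[[z [d [c [e [zb a1E hd]]]]] t0]].
    left; rewrite ea; have := on_loop_forth tk; rewrite -ew => /(_ _ _ _ onl).
    by case: onl => _ -> ->; rewrite mulr0 addr0.
  right; split=> //; exists z, (d + 1)%R, c, e; split=> //.
    by rewrite a1E; ring.
  constructor 2; split; last by exists t'.
  case: hd => [[-> _]|[d0 _]|[d0 [t2 [tk2 hd wt2]]]] //; first by lia.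
  case: (nca t0); rewrite hd linvK ea; congr (nth _ _ _).
  by apply: (loop_vertex_injS tk tk2); rewrite -ew.
- exists (vtx t'.+1), (a1 - 2 * M * b1)%R, b1; rewrite qshift_sq; split.
    by congr (single _ (qsq _ _)); ring.
  case: inv => [onl|[[z [d [c [e [zb a1E hd]]]]] t0]].
    left; rewrite ea; have := on_loop_back tk; rewrite -ew => /(_ _ _ _ onl).
    by case: onl => _ -> ->; rewrite mulr0 subr0.
  right; split=> //; exists z, (d - 1)%R, c, e; split=> //.
    by rewrite a1E; ring.
  constructor 3; split; last by exists t'.
  case: hd => [[-> _]|[d0 [t2 [tk2 hd wt2]]]|[d0 _]] //; last by lia.
  case: (nca t0); rewrite hd ea; congr (linv (nth _ _ _)).
  by apply: (loop_vertex_inj tk tk2); rewrite -ew.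
- suff lt : (`|b1| < `|a1 - 2 * offset a.2 e * b1|)%R.
    have [a' [b' [-> off]]] := off_loop_new w' ea lt.
    by exists w', a', b'; split=> //; right.
  case: inv => [[_ -> ->]|[[z [d [c [e' [zb a1E hd]]]]] t0]].
    by rewrite mulr0 subr0.
  rewrite a1E (_ : _ - _ = z + 2 * (M * d + offset c e' - offset a.2 e) * b1)%R.
    2: by ring.
  apply: shift_grow => //; apply/eqP => c0.
  have d0 : d = 0%R.
    move: c0 (offset_ge0 c e') (offset_ge0 a.2 e) (offset_lt c e') (offset_lt a.2 e).
    move: M (offset _ _) (offset _ _) => m o o' c0 o0 o0' om om'.
    apply/eqP; apply/negPn/negP => d0.
    have : (`|m| <= `|m * d|)%R by rewrite normrM ler_peMr //; lia.
    by lia.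
  case: hd => [[_ hd]|[]|[]]; [|by rewrite d0|by rewrite d0].
  move: c0; rewrite d0 mulr0 add0r => /eqP; rewrite subr_eq0 => /eqP.
  case/offset_inj => cE eE; apply: (nca t0).
  by rewrite hd /linv /= negbK cE eE ea -surjective_pairing.
Qed.

Lemma act_coefficient f :
  (exists z, f = zexp u z) \/
  (ldot (single base (qsq 1 0)) (act f (single base (qsq 1 0))) <= 0)%R.
Proof.
have [t -> rt] := reduced_word xfree f.
have [w [a [b [E inv]]]] := reduced_walk rt.
rewrite E ldot_single; case: eqP => [ew|_]; last by right.
case: inv => [[[t' [z [tk wt' ->]]] _ _]|[[z [d [c [e [zb _ _]]]]] _]].
  left; exists (1 + z)%R; rewrite zexpS.
  by rewrite -(loop_vertex_inj k_gt0 tk) ?drop0 // -wt'.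
by right; rewrite qdot_sq; nia.
Qed.

(** An element that acts trivially is a power of [u]; a nonzero power acts at the
    base as a nontrivial shift, which moves [qmk 0 0 0 1]. *)
Lemma act_faithful f : (forall v, act f v = v) -> f = 1.
Proof.
move=> fix_f; case: (act_coefficient f) => [[z fE]|]; last first.
  by rewrite fix_f ldot_single eqxx qdot_sq.
move: (fix_f (single base (qmk 0 0 0 1))); rewrite fE act_loop => /single_inj [_].
have M0 : (0 < M)%R.
  by apply: le_lt_trans (offset_ge0 true (base, a0.1)) (offset_lt _ _).
have k0 : (0 < k%:Z)%R by [].
rewrite add0r mulr1 => /eqP; rewrite !mulf_eq0 (gt_eqF M0) (gt_eqF k0) /= => /eqP ->.
exact: zexp0.
Qed.
End Action.

End Loop.

(** The size of the representation can be prescribed from some point on, so that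
    the representations for several elements can be given a common space. *)
Theorem cyclic_separation (F : groupType) n (x : 'I_n -> F) (u : F) :
  free_basis x -> u <> 1 -> exists l0, forall l, (l0 <= l)%N ->
  exists (act : {multiplicative F -> bij (lattice 'I_l.+1)}) (e : lattice 'I_l.+1),
  [/\ forall f, isometric (@ldot _) (act f), act u e = e, ldot e e = 1%R,
      forall f, (exists z, f = zexp u z) \/ (ldot e (act f e) <= 0)%R
    & forall f, (forall v, act f v = v) -> f = 1].
Proof.
move=> xfree u1; have [s [h [s0 cs ->]]] := cyclically_reduced_conj xfree u1.
case: s s0 cs => // a0 p _ cs; exists (size p) => l pl.
have [act actx _] := xfree _ (fun j =>
  mono (@loop_perm n l a0 p cs pl j) (@loop_label n l a0 p j)).
have iso f := act_iso xfree actx f.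
set e0 := single (@loop_vertex n l a0 p 0) (qsq 1 0).
exists act, (act h e0); split=> [//||||].
- rewrite !gmulfM gmorphV !bijME bijKV; congr (act h _).
  by have := act_loop actx 1 (qsq 1 0); rewrite zexp1 qshift_sq mulr0 addr0.
- by have [_ ->] := iso h; rewrite ldot_single eqxx qdot_sq.
- move=> f; have [[z E]|le] := act_coefficient xfree actx (h^-1 * f * h).
    left; exists z; rewrite zexp_conj -E !mulgA mulgV mul1g mulgK //.
  by right; move: le; rewrite -(proj2 (iso h^-1)) !gmulfM gmorphV !bijME bijKV.
- by move=> f; apply: (act_faithful xfree actx).
Qed.

Local Open Scope ring_scope.

(** * Ping-pong with parabolic isometries *)

Definition rdot r (a b : 'rV[int]_r) : int := \sum_k a 0 k * b 0 k.

Lemma rdotC r (a b : 'rV[int]_r) : rdot a b = rdot b a.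
Proof. by apply: eq_bigr => k _; rewrite mulrC. Qed.

Lemma rdotD r (a b c : 'rV[int]_r) : rdot (a + b) c = rdot a c + rdot b c.
Proof. by rewrite /rdot -big_split; apply: eq_bigr => k _; rewrite mxE mulrDl. Qed.

Lemma rdotP r k (a b c : 'rV[int]_r) : rdot (k *: a + b) c = k * rdot a c + rdot b c.
Proof.
rewrite rdotD; congr (_ + _); rewrite /rdot mulr_sumr; apply: eq_bigr => j _.
by rewrite mxE mulrA.
Qed.

Lemma rdot0l r (a : 'rV[int]_r) : rdot 0 a = 0.
Proof. by rewrite /rdot big1 // => k _; rewrite mxE mul0r. Qed.

Lemma rdot_delta r (a : 'rV[int]_r) k : rdot a (delta_mx 0 k) = a 0 k.
Proof.
rewrite /rdot (bigD1 k) //= big1 => [|j /negbTE jk].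
  by rewrite mxE !eqxx mulr1 addr0.
by rewrite mxE jk andbF mulr0.
Qed.

Lemma rdot_ge_norm1 r (a : 'rV[int]_r) : \sum_k `|a 0 k| <= rdot a a.
Proof. by apply: ler_sum => k _; move: (a 0 k) => t; nia. Qed.

Lemma rdot_ge_coord r (a : 'rV[int]_r) k : `|a 0 k| <= rdot a a.
Proof.
apply: le_trans (rdot_ge_norm1 a); rewrite (bigD1 k) //= lerDl.
by apply: sumr_ge0.
Qed.

Lemma rdot_gt0 r (a : 'rV[int]_r) : a != 0 -> 0 < rdot a a.
Proof.
move=> a0; have /rV0Pn [k ak] := a0.
by apply: lt_le_trans (rdot_ge_coord a k); rewrite normr_gt0.
Qed.

Section Parabolic.
Variables (V : lmodType int) (B : V -> V -> int) (r : nat).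
Variable eps : {linear 'rV[int]_r -> V}.
Hypothesis BC : forall u v, B u v = B v u.
Hypothesis BP : forall k u v w, B (k *: u + v) w = k * B u w + B v w.
Hypothesis B_eps : forall a b, B (eps a) (eps b) = rdot a b.

Lemma formD u v w : B (u + v) w = B u w + B v w.
Proof. by have := BP 1 u v w; rewrite scale1r mul1r. Qed.
Lemma formZ k u w : B (k *: u) w = k * B u w.
Proof.
by have := BP k u 0 w; rewrite !addr0 (form_left0 BP) addr0.
Qed.
Lemma formDr w u v : B w (u + v) = B w u + B w v.
Proof. by rewrite BC formD !(BC w). Qed.
Lemma formZr k w u : B w (k *: u) = k * B w u.
Proof. by rewrite BC formZ (BC w). Qed.

Lemma form0r w : B w 0 = 0. Proof. by rewrite -(scale0r 0) formZr mul0r. Qed.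

Lemma formNr w u : B w (- u) = - B w u.
Proof. by rewrite -scaleN1r formZr mulN1r. Qed.

(** The Eichler transvection at the isotropic vector [4 d] in the direction [a].
    The factor 4 makes it push strongly enough towards [d] in [parabolic_push],
    even for the shortest directions. *)
Definition parabolic_fun (d : V) (a : 'rV[int]_r) (v : V) : V :=
  v + ((4 * B v d) *: eps a - (4 * B v (eps a) + 8 * rdot a a * B v d) *: d).

Definition cusp (d : V) : Prop := B d d = 0 /\ forall a, B (eps a) d = 0.

Lemma parabolic_funD d a b v : cusp d ->
  parabolic_fun d a (parabolic_fun d b v) = parabolic_fun d (a + b) v.
Proof.
move=> [dd ed]; set v' := parabolic_fun d b v.
have v'd : B v' d = B v d.
  by rewrite /v' /parabolic_fun -scaleNr !formD !formZ dd ed; ring.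
have v'e : B v' (eps a) = B v (eps a) + 4 * B v d * rdot b a.
  by rewrite /v' /parabolic_fun -scaleNr !formD !formZ B_eps (BC d) ed; ring.
rewrite {1}/parabolic_fun v'd v'e /v' /parabolic_fun -addrA; congr (_ + _).
rewrite linearD /= scalerDr addrACA [_ *: eps b + _]addrC; congr (_ + _).
rewrite -opprD -scalerDl; congr (- (_ *: _)).
by rewrite formDr rdotD !(rdotC _ (a + b)) !rdotD (rdotC b a); ring.
Qed.

Lemma parabolic_fun0 d v : parabolic_fun d 0 v = v.
Proof.
rewrite /parabolic_fun linear0 scaler0 form0r rdot0l !mulr0 mul0r.
by rewrite !scale0r subrr addr0.
Qed.

Lemma parabolic_funK d a : cusp d ->
  cancel (parabolic_fun d a) (parabolic_fun d (- a)).
Proof. by move=> cd v; rewrite parabolic_funD // addNr parabolic_fun0. Qed.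
Lemma parabolic_funVK d a : cusp d ->
  cancel (parabolic_fun d (- a)) (parabolic_fun d a).
Proof. by move=> cd v; rewrite parabolic_funD // addrN parabolic_fun0. Qed.
Definition parabolic d a (cd : cusp d) : bij V :=
  Bij (parabolic_funK a cd) (parabolic_funVK a cd).

Lemma parabolic_linear d a : linear (parabolic_fun d a).
Proof.
move=> k u v; rewrite /parabolic_fun !BP.
set x := B u d; set y := B v d; set z := B u _; set t := B v _; set q := rdot a a.
rewrite [in RHS]scalerDr [RHS]addrACA; congr (_ + _).
rewrite scalerBr !scalerA [RHS]addrACA -scalerDl -opprD -scalerDl.
by congr (_ *: _ - _ *: _); ring.
Qed.

Lemma parabolic_conj (g : bij V) d a v : isometric B g -> g (eps a) = eps a ->
  g (parabolic_fun d a v) = parabolic_fun (g d) a (g v).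
Proof.
move=> ig ga; have [gl gB] := ig; have gD : forall u w, g (u + w) = g u + g w.
  by move=> u w; have := gl 1 u w; rewrite !scale1r.
have gZ : forall k u, g (k *: u) = k *: g u.
  by move=> k u; have := gl k u 0; rewrite (isometric0 ig) !addr0.
have ge : B (g v) (eps a) = B v (eps a) by rewrite -{1}ga gB.
by rewrite /parabolic_fun gB ge !gD -!scaleNr !gZ ga.
Qed.

Section PingPong.
Variables (D : V -> Prop) (v0 : V).
Hypothesis D_cusp : forall d, D d -> cusp d.
Hypothesis D_far : forall d d', D d -> D d' -> d <> d' -> B d d' <= -2.
Hypothesis v0_eps : forall a, B v0 (eps a) = 0.
Hypothesis v0_D : forall d, D d -> B v0 d < 0.

(** That [B v (d + eps b) < 0] for all small [b] means that every coordinate of the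
    projection of [v] along [eps] is smaller in absolute value than [- B v d]. *)
Inductive small : 'rV[int]_r -> Prop :=
| small0 : small 0
| small_pos k : small (delta_mx 0 k)
| small_neg k : small (- delta_mx 0 k).

Lemma small_rdot a b : small b -> `|rdot a b| <= rdot a a.
Proof.
case=> [|k|k].
- by rewrite rdotC rdot0l normr0; apply: sumr_ge0 => k _; rewrite -expr2 sqr_ge0.
- by rewrite rdot_delta; exact: rdot_ge_coord.
- have -> : - delta_mx 0 k = -1 *: delta_mx 0 k + 0 :> 'rV[int]_r.
    by rewrite addr0 scaleN1r.
  rewrite rdotC rdotP rdotC rdot_delta.
  by rewrite rdot0l addr0 mulN1r normrN; exact: rdot_ge_coord.
Qed.

Lemma form_eps_le v (d : V) a : (forall b, small b -> B v (d + eps b) < 0) ->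
  `|B v (eps a)| <= - B v d * rdot a a.
Proof.
move=> neg.
have Bk k : `|B v (eps (delta_mx 0 k))| <= - B v d.
  have := neg _ (small_pos k); have := neg _ (small_neg k).
  rewrite !formDr linearN formNr /=.
  by move: (B v (eps 'e_k)) => t; move: (B v d) => s; lia.
have -> : B v (eps a) = \sum_k a 0 k * B v (eps (delta_mx 0 k)).
  rewrite {1}(row_sum_delta a) linear_sum /=.
  elim/big_rec2: _ => [|k s w _ IH]; first exact: form0r.
  by rewrite formDr IH linearZ formZr.
have d0 : 0 <= - B v d.
  by have := neg 0 small0; rewrite linear0 addr0; lia.
apply: le_trans (ler_norm_sum _ _ _) _.
apply: le_trans (ler_wpM2l d0 (rdot_ge_norm1 a)); rewrite mulr_sumr.
by apply: ler_sum => k _; rewrite normrM mulrC ler_wpM2r.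
Qed.

(** The displacement of [v] is [M d - 4 X eps a] with [X = - B v d], where
    [M >= 4 X (a . a)] dominates: towards any other cusp it lowers [B], by at least
    [M], and at [d] itself it raises [B] by at most [M]. *)
Lemma parabolic_push d a v : D d -> a != 0 ->
    (forall b, small b -> B v (d + eps b) < 0) ->
  exists M z, [/\ parabolic_fun d a v = v + z, 0 < - B v d <= M,
    forall d' b, D d' -> d' <> d -> small b -> B z (d' + eps b) <= - M,
    forall b, small b -> B z (d + eps b) <= M & B z v0 < 0].
Proof.
move=> Dd a0 neg; have [dd ed] := D_cusp Dd.
have q0 := rdot_gt0 a0; have Y := form_eps_le a neg.
have X0 : 0 < - B v d by have := neg 0 small0; rewrite linear0 addr0; lia.
pose X := - B v d; pose q := rdot a a; pose M := 8 * q * X - 4 * B v (eps a).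
have qX : X <= q * X by rewrite ler_peMl //; lia.
have MqX : 4 * (q * X) <= M.
  by move: Y; rewrite -/X -/q mulrC /M -mulrA; move: (q * X) (B v _) => s t; lia.
have M0 : 0 < M by lia.
exists M, ((- (4 * X)) *: eps a + M *: d); split.
- rewrite /parabolic_fun; congr (_ + _); rewrite -scaleNr.
  by congr (_ *: _ + _ *: _); rewrite /X /M /X /q; ring.
- by rewrite X0 /=; lia.
- move=> d' b Dd' dd' sb; rewrite formD !formZ !formDr B_eps.
  have [_ ed'] := D_cusp Dd'; rewrite ed' (BC d (eps b)) ed.
  have := D_far Dd Dd' (fun e => dd' (esym e)); have := small_rdot a sb.
  rewrite -/q; move: (rdot a b) (B d d') => s t ss tt.
  have : `|X * s| <= q * X by rewrite mulrC normrM ler_pM // ger0_norm //; lia.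
  by rewrite add0r addr0; nia.
- move=> b sb; rewrite formD !formZ !formDr B_eps ed dd (BC d (eps b)) ed.
  have := small_rdot a sb; rewrite -/q; move: (rdot a b) => s ss.
  have : `|X * s| <= q * X by rewrite mulrC normrM ler_pM // ger0_norm //; lia.
  by rewrite add0r addr0 mulr0 addr0; lia.
- rewrite formD !formZ (BC _ v0) v0_eps mulr0 add0r (BC _ v0) pmulr_rlt0 //.
  exact: v0_D.
Qed.

Definition head_cusp (s : seq (V * 'rV[int]_r)) : option V := ohead (map fst s).

Fixpoint alternating (s : seq (V * 'rV[int]_r)) : Prop :=
  if s is (d, a) :: s' then
    [/\ D d, a != 0, head_cusp s' <> Some d & alternating s'] else True.

Definition parabolic_word (s : seq (V * 'rV[int]_r)) : V :=
  foldr (fun p v => parabolic_fun p.1 p.2 v) v0 s.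

(** The cusp visited last is the only one at which [B v] may have become
    nonnegative, and then it is more negative at all the other cusps.  The vector
    [v0] itself witnesses that the word moves it. *)
Lemma ping_pong_invariant s : alternating s -> let v := parabolic_word s in
  [/\ forall d b, D d -> head_cusp s <> Some d -> small b -> B v (d + eps b) < 0,
      forall d d' b b', D d -> D d' -> head_cusp s = Some d -> d' <> d ->
        small b -> small b' -> B v (d + eps b) + B v (d' + eps b') < 0
    & B v v0 <= B v0 v0 ?= iff (s == [::])].
Proof.
elim: s => [_|[d1 a] s IH] /=.
  split=> [d b Dd _ _|//|]; last by split; rewrite ?eqxx.
  by rewrite formDr v0_eps addr0; exact: v0_D.
move=> [Dd1 a0 hs /IH]; set v := parabolic_word s => -[I1 I2 I3].
have [M [z [-> X0M zfar znear zv0]]] := parabolic_push Dd1 a0 (fun b => I1 _ b Dd1 hs).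
have [X0 XM] : 0 < - B v d1 /\ - B v d1 <= M by apply/andP.
split.
- move=> d b Dd nd sb; rewrite formD.
  have dd1 : d <> d1 by move=> e; apply: nd; rewrite /head_cusp /= e.
  have := zfar _ _ Dd dd1 sb.
  case: (pselect (head_cusp s = Some d)) => [hd|hd]; last first.
    by have := I1 _ _ Dd hd sb; lia.
  have := I2 _ _ _ _ Dd Dd1 hd (fun e => dd1 (esym e)) sb small0.
  by rewrite linear0 addr0; lia.
- move=> _ d b b' _ Dd [<-] dd1 sb sb'; rewrite !(formD v).
  have := zfar _ _ Dd dd1 sb'; have := znear _ sb.
  have P1 := I1 _ _ Dd1 hs sb.
  case: (pselect (head_cusp s = Some d)) => [hd|hd].
    by have := I2 _ _ _ _ Dd Dd1 hd (fun e => dd1 (esym e)) sb' sb; lia.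
  by have := I1 _ _ Dd hd sb'; lia.
- rewrite formD; case: I3 => le _; split; first by lia.
  by apply/eqP => e; lia.
Qed.

Lemma ping_pong s : alternating s -> s <> [::] -> parabolic_word s <> v0.
Proof.
move=> alt s0 e; have [_ _ [_]] := ping_pong_invariant alt.
by rewrite /= e eqxx => /esym/eqP.
Qed.
End PingPong.
End Parabolic.

Local Open Scope ring_scope.

(** * The representation space of a family of separated elements *)

Section Sum.
Variables (T : finType) (V : vectType int) (B : V -> V -> int) (r : nat).
Hypothesis BC : forall u v, B u v = B v u.
Hypothesis BP : forall k u v w, B (k *: u + v) w = k * B u w + B v w.

Definition rep_space : Type := ({ffun T -> V} * int^o * 'rV[int]_r)%type.
HB.instance Definition _ := Vector.on rep_space.

Definition rep_mk (p : {ffun T -> V}) (z : int) (a : 'rV[int]_r) : rep_space :=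
  (p, z, a).

(** The negative coordinate makes all cusps pair negatively; the factors 2 leave
    room for the products of two small vectors, which are at most 1. *)
Definition rep_form (v w : rep_space) : int :=
  2 * (\sum_t B (v.1.1 t) (w.1.1 t)) - 2 * (v.1.2 * w.1.2) + rdot v.2 w.2.

Lemma rep_formC v w : rep_form v w = rep_form w v.
Proof.
rewrite /rep_form rdotC [v.1.2 * _]mulrC; congr (_ * _ - _ + _).
by apply: eq_bigr => t _.
Qed.

Lemma rep_formP k u v w : rep_form (k *: u + v) w = k * rep_form u w + rep_form v w.
Proof.
case: u v w => [[p z] a] [[p' z'] a'] [[p2 z2] a2]; rewrite /rep_form /= rdotP.
rewrite (eq_bigr (fun t => k * B (p t) (p2 t) + B (p' t) (p2 t))) => [|t _].
  rewrite big_split -mulr_sumr /=; change (k *: (z : int^o)) with (k * z); ring.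
by rewrite !ffunE BP.
Qed.

Definition rep_eps (a : 'rV[int]_r) : rep_space := rep_mk 0 0 a.

Lemma rep_eps_linear : linear rep_eps.
Proof.
by move=> k a b; rewrite /rep_eps /rep_mk; congr (_, _, _); rewrite /= ?scaler0 ?addr0.
Qed.
HB.instance Definition _ :=
  GRing.isLinear.Build int 'rV[int]_r rep_space _ rep_eps rep_eps_linear.

Let form00 w : B 0 w = 0 := form_left0 BP w.

Lemma rep_form_eps a b : rep_form (rep_eps a) (rep_eps b) = rdot a b.
Proof.
rewrite /rep_form big1 => [|t _]; last by rewrite ffunE form00.
by rewrite /= !mulr0 subr0 add0r.
Qed.

Definition axis : rep_space := rep_mk 0 1 0.

Lemma rep_form_axis v : rep_form axis v = - 2 * v.1.2.
Proof.
rewrite /rep_form big1 => [|t _]; last by rewrite ffunE form00.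
by rewrite /= rdot0l; ring.
Qed.

Section Action.
Variables (F : groupType) (act : T -> {multiplicative F -> bij V}).
Hypothesis act_iso : forall t f, isometric B (act t f).

Definition rep_act_fun (f : F) (v : rep_space) : rep_space :=
  rep_mk [ffun t => act t f (v.1.1 t)] v.1.2 v.2.

Lemma rep_act_funM f g v : rep_act_fun (f * g)%g v = rep_act_fun f (rep_act_fun g v).
Proof.
rewrite /rep_act_fun /=; congr (rep_mk _ _ _); apply/ffunP => t.
by rewrite !ffunE gmulfM.
Qed.

Lemma rep_act_fun1 v : rep_act_fun 1%g v = v.
Proof.
case: v => [[p z] a]; congr (rep_mk _ _ _); apply/ffunP => t.
by rewrite ffunE gmorph1.
Qed.

Lemma rep_act_funK f : cancel (rep_act_fun f) (rep_act_fun f^-1%g).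
Proof. by move=> v; rewrite -rep_act_funM mulVg rep_act_fun1. Qed.
Lemma rep_act_funVK f : cancel (rep_act_fun f^-1%g) (rep_act_fun f).
Proof. by move=> v; rewrite -rep_act_funM mulgV rep_act_fun1. Qed.
Definition rep_act f : bij rep_space := Bij (rep_act_funK f) (rep_act_funVK f).

Lemma rep_actM : {morph rep_act : f g / (f * g)%g}.
Proof. by move=> f g; apply: bijP => v; exact: rep_act_funM. Qed.
HB.instance Definition _ := isMultiplicative.Build F (bij rep_space) rep_act rep_actM.

Lemma rep_act_iso f : isometric rep_form (rep_act f).
Proof.
split=> [k u v|u v].
  rewrite /= /rep_act_fun; congr (_, _, _); apply/ffunP => t; rewrite !ffunE.
  by have [-> _] := act_iso t f.
congr (_ * _ - _ + _); apply: eq_bigr => t _.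
by rewrite !ffunE; have [_ ->] := act_iso t f.
Qed.

Let act0 t f : act t f 0 = 0 := isometric0 (act_iso t f).

Lemma rep_act_eps f a : rep_act f (rep_eps a) = rep_eps a.
Proof. by congr (rep_mk _ _ _); apply/ffunP => t; rewrite !ffunE act0. Qed.

Lemma rep_act_axis f : rep_act f axis = axis.
Proof. by congr (rep_mk _ _ _); apply/ffunP => t; rewrite !ffunE act0. Qed.

Lemma rep_act_faithful t f : (forall v, rep_act f v = v) -> forall v, act t f v = v.
Proof.
move=> fix_f v; have := fix_f (rep_mk [ffun=> v] 0 0).
by case=> /ffunP/(_ t); rewrite !ffunE.
Qed.

Variables (u : T -> F) (e : T -> V).
Hypothesis act_u : forall t, act t (u t) (e t) = e t.
Hypothesis e_norm : forall t, B (e t) (e t) = 1.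
Hypothesis e_sep : forall t f,
  (exists z, f = zexp (u t) z) \/ B (e t) (act t f (e t)) <= 0.

(** Isotropic because [e t] has norm 1; vectors of different families share only
    the negative coordinate, which gives the product -2. *)
Definition cusp_vector (t : T) : rep_space :=
  rep_mk [ffun s => if s == t then e t else 0] 1 0.

Lemma cusp_vector_fix t z : rep_act (zexp (u t) z) (cusp_vector t) = cusp_vector t.
Proof.
have fix_u : rep_act (u t) (cusp_vector t) = cusp_vector t.
  congr (rep_mk _ _ _); apply/ffunP => s; rewrite !ffunE.
  by case: eqP => [->|_]; rewrite ?act_u ?act0.
apply: (@zexp_ind _ (fun g => rep_act g (cusp_vector t) = cusp_vector t)).
- by rewrite gmorph1.
- by move=> g IH; rewrite gmulfM bijME IH.
- by move=> g IH; rewrite gmulfM bijME IH -{1}fix_u gmorphV bijKV.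
Qed.

Lemma rep_form_delta f g t s :
  rep_form (rep_act f (cusp_vector t)) (rep_act g (cusp_vector s)) =
  if t == s then 2 * B (e t) (act t (f^-1 * g)%g (e t)) - 2 else - 2.
Proof.
have [_ iso] := rep_act_iso f^-1%g.
rewrite -iso -!bijME -!gmulfM mulVg gmorph1 bij1E /rep_form /= rdot0l addr0 mulr1.
rewrite (bigD1 t) //= big1 => [|q qt]; last by rewrite ffunE (negbTE qt) form00.
rewrite !ffunE eqxx addr0; case: eqP => [->//|_].
by rewrite act0 BC form00 mulr0 sub0r.
Qed.

(** Both the disjointness of the orbits and the determination of the stabilizers
    come out of this alternative, since cusps are isotropic. *)
Lemma cusp_vector_alternative f g t s :
  (t = s /\ exists z, g = (f * zexp (u t) z)%g) \/
  rep_form (rep_act f (cusp_vector t)) (rep_act g (cusp_vector s)) <= - 2.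
Proof.
rewrite rep_form_delta; case: eqP => [<-|_]; last by right.
case: (e_sep t (f^-1 * g)%g) => [[z E]|le]; last by right; lia.
by left; split=> //; exists z; rewrite -E mulVKg.
Qed.

Definition in_cusp_orbit (d : rep_space) : Prop :=
  exists f t, d = rep_act f (cusp_vector t).

Lemma in_cusp_orbitP d : in_cusp_orbit d -> cusp rep_form rep_eps d.
Proof.
move=> [f [t ->]]; split=> [|a].
  by rewrite rep_form_delta eqxx mulVg gmorph1 bij1E e_norm; lia.
rewrite /= -(rep_act_eps f) (proj2 (rep_act_iso f)) /rep_form big1 => [|s _].
  by rewrite /= rdotC rdot0l mul0r mulr0 subr0 addr0.
by rewrite ffunE form00.
Qed.

Lemma cusp_vector_inj f g t s : rep_act f (cusp_vector t) = rep_act g (cusp_vector s) ->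
  t = s /\ exists z, g = (f * zexp (u t) z)%g.
Proof.
move=> E; case: (cusp_vector_alternative f g t s) => //; rewrite -E.
suff [-> _] : cusp rep_form rep_eps (rep_act f (cusp_vector t)) by [].
by apply: in_cusp_orbitP; exists f, t.
Qed.

Lemma in_cusp_orbit_far d d' :
  in_cusp_orbit d -> in_cusp_orbit d' -> d <> d' -> rep_form d d' <= - 2.
Proof.
move=> [f [t ->]] [g [s ->]] ne.
case: (cusp_vector_alternative f g t s) => // -[ts [z gE]]; case: ne.
by rewrite -ts gE gmulfM bijME cusp_vector_fix.
Qed.

Lemma rep_form_axis_cusp d : in_cusp_orbit d -> rep_form axis d < 0.
Proof. by move=> [f [t ->]]; rewrite rep_form_axis. Qed.

End Action.
End Sum.

Local Open Scope group_scope.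

(** * Coordinates on a leaf group *)

Lemma zexp_mulgroup (Z : zmodType) (a : mulgroup Z) z : zexp a z = ((a : Z) *~ z)%R.
Proof.
elim/int_rect: z => [//|i IH|i IH]; first by rewrite intS zexpS IH mulrzDr.
by rewrite intS opprD zexpD IH mulrzDr.
Qed.

(** In a basis containing [w], [chi] is the coordinate along [w] and [lam] collects
    the others, padded with zeros so that all the leaves can use the same [r]. *)
Lemma leaf_coordinates (K : groupType) (w : K) : abelian_group K -> primitive w ->
  exists r0, forall r, (r0 <= r)%N ->
  exists (chi : {multiplicative K -> mulgroup int})
         (lam : {multiplicative K -> mulgroup 'rV[int]_r}),
  [/\ chi w = 1%R, lam w = 0%R & forall x, chi x = 0%R -> lam x = 0%R -> x = 1].
Proof.
move=> Kab [n [x [xb [j0 ->]]]]; have [c [cx c_inj]] := free_abelian_basis_coord Kab xb.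
exists n => r nr.
pose chi0 (g : K) : mulgroup int := (c g : 'rV[int]_n) 0%R j0.
pose lam0 (g : K) : mulgroup 'rV[int]_r := (\row_k
  if insub (k : nat) is Some j then
    if j == j0 then 0 else (c g : 'rV[int]_n) 0 j else 0)%R.
have chiM : {morph chi0 : a b / a * b}.
  by move=> a b; rewrite /chi0 gmulfM; exact: mxE.
have lamM : {morph lam0 : a b / a * b}.
  move=> a b; apply/rowP => k; rewrite /lam0 gmulfM; apply: etrans (esym (mxE _ _ _ _)).
  rewrite !mxE; case: insubP => [j _ _|_]; last by rewrite addr0.
  by case: eqP => _; rewrite ?addr0 // mxE.
pose chi : {multiplicative K -> mulgroup int} :=
  HB.pack chi0 (isMultiplicative.Build K _ _ chiM).
pose lam : {multiplicative K -> mulgroup 'rV[int]_r} :=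
  HB.pack lam0 (isMultiplicative.Build K _ _ lamM).
exists chi, lam; split.
- by rewrite /= /chi0 cx mxE !eqxx.
- apply/rowP => k; rewrite /= /lam0 cx !mxE; case: insubP => [j _ _|//].
  by case: eqP => // /eqP/negbTE j0j; rewrite mxE j0j andbF.
- move=> g chi_g lam_g; apply: c_inj; apply/rowP => j; rewrite [RHS]mxE.
  have [->|jj0] := eqVneq j j0; first exact: chi_g.
  have jr : (j < r)%N := leq_trans (ltn_ord j) nr.
  move/rowP/(_ (Ordinal jr)): lam_g; rewrite /= /lam0 !mxE /=.
  by rewrite valK (negbTE jj0).
Qed.

(** * From actions on lattices to integral matrices *)

Lemma Z_linear_of_action (G : groupType) (V : vectType int)
    (h : {multiplicative G -> bij V}) :
  (forall g, linear (h g)) -> (forall g, (forall v, h g v = v) -> g = 1) ->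
  Z_linear G.
Proof.
move=> hl hf; (* The transpose turns the action on row vectors into a left action. *)
pose rep g := (lin1_mx (fun a => v2r (h g (r2v a))))^T%R.
have repE g (a : 'rV[int]_(dim V)) : (a *m (rep g)^T = v2r (h g (r2v a)))%R.
  have lf : linear (fun a : 'rV[int]_(dim V) => v2r (h g (r2v a))).
    by move=> k b d; rewrite linearP hl linearP.
  pose f : {linear 'rV[int]_(dim V) -> 'rV[int]_(dim V)} :=
    HB.pack (fun a : 'rV[int]_(dim V) => v2r (h g (r2v a)))
      (GRing.isLinear.Build _ _ _ _ _ lf).
  by rewrite trmxK; exact: (mul_rV_lin1 f).
have rep_eq g (N : 'M[int]_(dim V)) :
    (forall a : 'rV_(dim V), a *m N^T = v2r (h g (r2v a)))%R -> rep g = N.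
  move=> NE; apply: trmx_inj; apply/row_matrixP => i.
  by rewrite !rowE repE NE.
have rep1 : rep 1 = 1%:M%R.
  by apply: rep_eq => a; rewrite trmx1 mulmx1 gmorph1 bij1E r2vK.
have repM (g g' : G) : rep (g * g') = (rep g *m rep g')%R.
  by apply: rep_eq => a; rewrite trmx_mul mulmxA !repE v2rK gmulfM.
exists (dim V), rep; split=> //.
  move=> g; suff /mulmx1_unit [] : (rep g *m rep g^-1%g = 1%:M)%R by [].
  by rewrite -repM mulgV.
move=> g g' E; apply: divg1_eq; apply: hf => v.
apply: v2r_inj; rewrite -{1}(v2rK v) -repE repM E -repM mulgV rep1.
by rewrite trmx1 mulmx1.
Qed.

(** * Extension to the fundamental group and normal forms *)

Section Representation.
Variables (m : nat) (GG : star_of_groups m).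
Variables (k : forall i, edge GG i) (r : nat).
Hypothesis k_gen : forall i, cyclic_generator (k i).
Hypothesis leaf_abelian : forall i, abelian_group (leaf GG i).
Variables (chi : forall i, {multiplicative leaf GG i -> mulgroup int})
  (lam : forall i, {multiplicative leaf GG i -> mulgroup 'rV[int]_r}).
Hypothesis chi_w : forall i, chi i (omega GG i (k i)) = 1%R.
Hypothesis lam_w : forall i, lam i (omega GG i (k i)) = 0%R.
Hypothesis coord_inj : forall i x, chi i x = 0%R -> lam i x = 0%R -> x = 1.

Variables (V : vectType int) (B : V -> V -> int).
Variable eps : {linear 'rV[int]_r -> V}.
Hypothesis BC : forall u v, B u v = B v u.
Hypothesis BP : forall c u v w, B (c *: u + v)%R w = (c * B u w + B v w)%R.
Hypothesis B_eps : forall a b, B (eps a) (eps b) = rdot a b.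

Local Notation F := (center GG).
Local Notation u i := (alpha GG i (k i)).
Local Notation w i := (omega GG i (k i)).

Variables (act : {multiplicative F -> bij V}) (D : V -> Prop) (v0 : V).
Variable delta : 'I_m -> V.
Hypothesis act_iso : forall f, isometric B (act f).
Hypothesis act_eps : forall f a, act f (eps a) = eps a.
Hypothesis act_v0 : forall f, act f v0 = v0.
Hypothesis act_faithful : forall f, (forall v, act f v = v) -> f = 1.
Hypothesis D_delta : forall f i, D (act f (delta i)).
Hypothesis D_cusp : forall d, D d -> cusp B eps d.
Hypothesis D_far : forall d d', D d -> D d' -> d <> d' -> (B d d' <= -2)%R.
Hypothesis v0_eps : forall a, B v0 (eps a) = 0%R.
Hypothesis v0_D : forall d, D d -> (B v0 d < 0)%R.
Hypothesis delta_fix : forall i z, act (zexp (u i) z) (delta i) = delta i.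
Hypothesis delta_inj : forall f g i j, act f (delta i) = act g (delta j) ->
  i = j /\ exists z, g = f * zexp (u i) z.

Lemma delta_cusp i : cusp B eps (delta i).
Proof. have := D_cusp (D_delta 1 i); by rewrite gmorph1. Qed.

(** The factor [<w_i>] of the leaf acts through [u_i] and the complement by
    parabolics at [delta i]; the two commute because [u_i] fixes [delta i]. *)
Definition leaf_act i (x : leaf GG i) : bij V :=
  zexp (act (u i)) (chi i x) * parabolic BC BP B_eps (lam i x) (delta_cusp i).

Lemma leaf_actE i x v :
  leaf_act x v = act (zexp (u i) (chi i x)) (parabolic_fun B eps (delta i) (lam i x) v).
Proof. by rewrite gmorph_zexp. Qed.

Lemma leaf_actM i : {morph @leaf_act i : x y / x * y}.
Proof.
move=> x y; apply: bijP => v; rewrite bijME !leaf_actE.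
have -> : zexp (u i) (chi i (x * y)) = zexp (u i) (chi i x) * zexp (u i) (chi i y).
  by rewrite gmulfM; exact: zexpD.
have -> : lam i (x * y) = (lam i x + lam i y)%R by rewrite gmulfM.
rewrite gmulfM bijME -(parabolic_funD BC BP B_eps) //; last exact: delta_cusp.
have E := @parabolic_conj _ B r eps (act (zexp (u i) (chi i y))) (delta i) (lam i x).
by rewrite E ?delta_fix //; exact: act_eps.
Qed.
HB.instance Definition _ i :=
  isMultiplicative.Build (leaf GG i) (bij V) (@leaf_act i) (@leaf_actM i).

Lemma chi_zexp i z : chi i (zexp (w i) z) = z.
Proof. by rewrite gmorph_zexp chi_w zexp_mulgroup -mulrzl mulr1 intz. Qed.

Lemma lam_zexp i z : lam i (zexp (w i) z) = 0%R.
Proof. by rewrite gmorph_zexp lam_w zexp_mulgroup mul0rz. Qed.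

Lemma edge_act i (g : edge GG i) : act (alpha GG i g) = leaf_act (omega GG i g).
Proof.
have [z ->] := cyclic_generatorE g (@k_gen i).
apply: bijP => v; rewrite leaf_actE.
rewrite (gmorph_zexp (omega GG i)) (gmorph_zexp (alpha GG i)).
by rewrite chi_zexp lam_zexp parabolic_fun0.
Qed.

Section Extension.
Variable h : {multiplicative star_pi1 GG -> bij V}.
Hypothesis h_center : forall f, h (of_center f) = act f.
Hypothesis h_leaf : forall i (x : leaf GG i), h (of_leaf x) = leaf_act x.

Lemma extension_linear g : linear (h g).
Proof.
apply: (@star_pi1_ind _ GG (fun g => linear (h g))) g => [|f g IH|i x g IH] c v v'.
- by rewrite gmorph1.
- by rewrite gmulfM !bijME IH h_center; have [-> _] := act_iso f.
rewrite gmulfM !bijME IH h_leaf !leaf_actE (parabolic_linear eps BP).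
by have [-> _] := act_iso (zexp (u i) (chi i x)).
Qed.

(** An expression of an element as a product of conjugates of leaf elements
    without [w_i]-component, followed by an element of the center.  The list
    records the parabolics by which the conjugates act. *)
Inductive syllables : seq (V * 'rV[int]_r) -> star_pi1 GG -> Prop :=
| syllables_nil f : syllables [::] (of_center f)
| syllables_cons f i (x : leaf GG i) s g : chi i x = 0%R -> syllables s g ->
    syllables ((act f (delta i), lam i x : 'rV[int]_r) :: s)
      (of_center f * of_leaf x * (of_center f)^-1 * g).

Lemma syllables_center f s g : syllables s g ->
  syllables [seq (act f p.1, p.2) | p <- s] (of_center f * g).
Proof.
elim=> {s g} [f'|f' i x s g chi_x _ IH] /=; first by rewrite -gmulfM; left.
have := syllables_cons (f * f') chi_x IH.
by rewrite (@gmulfM _ _ act) of_centerM !invgM !mulgA mulgVK.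
Qed.

Lemma of_leaf_zexp i z : of_leaf (zexp (w i) z) = of_center (zexp (u i) z).
Proof. by rewrite !gmorph_zexp /= -of_edge. Qed.

Lemma syllables_leaf i (x : leaf GG i) s g : syllables s g ->
  exists s', syllables s' (of_leaf x * g).
Proof.
move=> sg; set c := chi i x : int; pose x' := x * zexp (w i) (- c)%R.
have chi_x' : chi i x' = 0%R.
  by rewrite /x' gmulfM chi_zexp; exact: (@addrN int c).
have := syllables_cons 1 chi_x' (syllables_center (zexp (u i) c) sg).
rewrite -of_leaf_zexp !gmorph1 invg1 mul1g mulg1 mulgA -gmulfM /x' -mulgA -zexpD.
by rewrite addNr zexp0 mulg1; eexists; eassumption.
Qed.

Lemma syllables_exist g : exists s, syllables s g.
Proof.
apply: (@star_pi1_ind _ GG (fun g => exists s, syllables s g)) g.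
- by exists [::]; rewrite -(gmorph1 (of_center (GG := GG))); left.
- by move=> f g [s /(syllables_center f)]; eexists; eassumption.
- by move=> i x g [s /(syllables_leaf x)].
Qed.

Lemma syllables_act s g : syllables s g -> h g v0 = parabolic_word B eps v0 s.
Proof.
elim=> {s g} [f|f i x s g chi_x _ IH]; first by rewrite h_center act_v0.
rewrite !gmulfM gmorphV !bijME h_center h_leaf IH leaf_actE chi_x zexp0 gmorph1.
rewrite (@parabolic_conj _ B r eps) //= ?act_eps //.
by rewrite bijVK.
Qed.

(** Two neighbouring syllables at the same cusp belong to the same leaf and to
    centers that differ by a power of [u_i]; this power lies in the leaf, which is
    abelian, so the syllables merge.  Syllables without direction are trivial. *)
Lemma syllables_alternating s g : syllables s g ->
  exists2 s', syllables s' g & alternating D s'.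
Proof.
elim=> {s g} [f|f i x s g chi_x _ [s' sg alt]]; first by exists [::] => //; left.
have [lam0|lam_x] := eqVneq (lam i x : 'rV[int]_r) 0%R.
  exists s' => //.
  by rewrite (coord_inj chi_x lam0) gmorph1 mulg1 mulgV mul1g.
have [hd|hd] := pselect (head_cusp s' = Some (act f (delta i))); last first.
  by exists ((act f (delta i), lam i x : 'rV[int]_r) :: s'); [right|].
case: sg alt hd => // f' j x' s2 g2 chi_x' sg2 [Dd' lam_x' hd2 alt2] [E].
have [ij [z f'E]] := delta_inj (esym E); subst j.
have -> : of_center f * of_leaf x * (of_center f)^-1 *
    (of_center f' * of_leaf x' * (of_center f')^-1 * g2) =
    of_center f * of_leaf (x * x') * (of_center f)^-1 * g2.
  have -> : of_center f' = of_center f * of_leaf (zexp (w i) z).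
    by rewrite f'E gmulfM of_leaf_zexp.
  rewrite gmulfM invgM !mulgA mulgVK; congr (_ * _ * _).
  rewrite -!mulgA; congr (_ * (_ * _)); rewrite -gmorphV -!gmulfM.
  by rewrite (leaf_abelian x' _) mulVKg.
have chi_xx' : chi i (x * x') = 0%R.
  by rewrite gmulfM chi_x chi_x'; exact: (@addr0 int 0).
have [lam0|lam_xx'] := eqVneq (lam i (x * x') : 'rV[int]_r) 0%R.
  exists s2 => //.
  by rewrite (coord_inj chi_xx' lam0) gmorph1 mulg1 mulgV mul1g.
exists ((act f (delta i), lam i (x * x') : 'rV[int]_r) :: s2); first by right.
by split=> //; rewrite -E.
Qed.

Lemma extension_faithful g : (forall v, h g v = v) -> g = 1.
Proof.
move=> fix_g; have [s0 /syllables_alternating [s sg alt]] := syllables_exist g.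
have act_g := syllables_act sg.
case: sg alt act_g fix_g => [f _ _ fix_f|].
  by rewrite (act_faithful (f := f)) ?gmorph1 // => v; rewrite -h_center.
move=> f i x s2 g2 chi_x sg2 alt E fix_g; exfalso.
apply: (ping_pong BC BP B_eps D_cusp D_far v0_eps v0_D alt) => //.
by rewrite -E fix_g.
Qed.

End Extension.

Theorem star_pi1_Z_linear : Z_linear (star_pi1 GG).
Proof.
have [h [h_center h_leaf]] := star_pi1_ext edge_act.
apply: (@Z_linear_of_action _ V h) => g.
  exact: extension_linear h_center h_leaf g.
exact: extension_faithful h_center h_leaf g.
Qed.

End Representation.

Local Open Scope group_scope.

(** * The fundamental group is linear over the integers *)

Lemma primitive_neq1 (K : groupType) (w : K) : abelian_group K -> primitive w -> w <> 1.
Proof.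
move=> Kab /(leaf_coordinates Kab) [r /(_ r (leqnn r))] [chi [_ [chi_w _ _]]] w1.
by move: chi_w; rewrite w1 gmorph1.
Qed.

Lemma Z_linear_trivial (G : groupType) : (forall g : G, g = 1) -> Z_linear G.
Proof.
move=> G1; exists 0%N, (fun=> 1%:M%R); split=> //.
- by move=> _; rewrite unitmx1.
- by move=> _ _; rewrite mulmx1.
- by move=> g g' _; rewrite (G1 g) (G1 g').
Qed.

Theorem theorem4p4 (m : nat) (GG : star_of_groups m)
    (center_free : free_of_finite_rank (center GG))
    (leaf_free_abelian : forall i : 'I_m, free_abelian_of_finite_rank (leaf GG i))
    (k : forall i : 'I_m, edge GG i)
    (k_generates : forall i : 'I_m, cyclic_generator (k i))
    (omega_primitive : forall i : 'I_m, primitive (omega GG i (k i))) :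
  Z_linear (star_pi1 GG).
Proof.
have leaf_ab i : abelian_group (leaf GG i) := proj1 (leaf_free_abelian i).
have u1 i : alpha GG i (k i) <> 1.
  move=> u1; apply: (primitive_neq1 (leaf_ab i) (omega_primitive i)).
  by rewrite (_ : k i = 1) ?gmorph1 //; apply: (@alpha_inj _ GG i); rewrite u1 gmorph1.
have [[f0 f01]|F1] := pselect (exists f : center GG, f <> 1); last first.
  have {}F1 (f : center GG) : f = 1 by apply: contrapT => f1; apply: F1; exists f.
  apply: Z_linear_trivial; apply: star_pi1_ind => [//|f x ->|i a x ->].
    by rewrite (F1 f) gmorph1 mulg1.
  by case: (u1 i); exact: F1.
(* The extra index None, with an arbitrary nontrivial element, makes the action of
   the center faithful even if the star has no edge. *)
have [n [x xfree]] := center_free.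
pose u (t : option 'I_m) := if t is Some i then alpha GG i (k i) else f0.
have u_neq1 t : u t <> 1 by case: t => [i|] //=; exact: u1.
have [l0 l0P] := choice (fun t => cyclic_separation xfree (u_neq1 t)).
pose l := \max_t l0 t.
have sep t := l0P t l (leq_bigmax t).
have [act {}sep] := choice sep; have [e {}sep] := choice sep.
have [r0 r0P] := choice (fun i => leaf_coordinates (leaf_ab i) (omega_primitive i)).
pose r := \max_i r0 i.
have coord i : exists c : {multiplicative leaf GG i -> mulgroup int} *
      {multiplicative leaf GG i -> mulgroup 'rV[int]_r},
    [/\ c.1 (omega GG i (k i)) = 1%R, c.2 (omega GG i (k i)) = 0%R
      & forall x, c.1 x = 0%R -> c.2 x = 0%R -> x = 1].
  by have [chi [lam ?]] := r0P i r (leq_bigmax i); exists (chi, lam).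
pose chi i := (sval (cid (coord i))).1; pose lam i := (sval (cid (coord i))).2.
have act_iso t f : isometric (@ldot _) (act t f) by case: (sep t).
have act_u t : act t (u t) (e t) = e t by case: (sep t).
have e_norm t : ldot (e t) (e t) = 1%R by case: (sep t).
have e_sep t f : (exists z, f = zexp (u t) z) \/ (ldot (e t) (act t f (e t)) <= 0)%R.
  by case: (sep t).
have BC := @ldotC 'I_l.+1; have BP := @ldotP 'I_l.+1.
apply: (@star_pi1_Z_linear m GG k r k_generates leaf_ab chi lam _ _ _ _ _ _
  (@rep_formC (option 'I_m) _ _ r BC) (rep_formP BP) (rep_form_eps _ BP) (rep_act r act)
  (in_cusp_orbit act e) (axis _ _ _) (fun i => cusp_vector r e (Some i))).
- by move=> i; rewrite /chi; case: (svalP (cid (coord i))).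
- by move=> i; rewrite /lam; case: (svalP (cid (coord i))).
- by move=> i; rewrite /chi /lam; case: (svalP (cid (coord i))).
- exact: rep_act_iso.
- exact: rep_act_eps act_iso.
- exact: rep_act_axis act_iso.
- move=> f /(rep_act_faithful None); case: (sep None) => _ _ _ _; exact.
- by move=> f i; exists f, (Some i).
- by move=> d /(in_cusp_orbitP BC BP act_iso e_norm).
- by move=> d d'; exact: in_cusp_orbit_far.
- by move=> a; rewrite (rep_form_axis BP) mulr0.
- by move=> d /(rep_form_axis_cusp BP).
- by move=> i z; have := cusp_vector_fix r act_iso act_u (Some i) z.
- by move=> f g i j /(cusp_vector_inj BC BP act_iso e_norm e_sep) [[<-]].
Qed.
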